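(* Let $\mathfrak g$ be a nilpotent real Lie algebra of real dimension $8$ endowed with a complex structure $J$. Then $(\mathfrak g,J)$ admits a $2$-Kähler structure if and only if $\mathfrak g$ is abelian.
   Context: A complex structure on a real Lie algebra $\mathfrak g$ is an endomorphism $J$ with $J^2=-\mathrm{Id}$ that is integrable (vanishing Nijenhuis tensor); $d$ denotes the Chevalley–Eilenberg differential. Positivity. Let $V$ be a complex vector space of dimension $n$ and $\Lambda^{p,q}$ the space of $(p,q)$-forms on $V$. An $(n,n)$-form $\nu$ is positive if $\nu=c\,i\alpha^1\wedge\overline{\alpha^1}\wedge\cdots\wedge i\alpha^n\wedge\overline{\alpha^n}$ with $c\in\mathbb R_{\ge0}$ and $\{\alpha^j\}$ a basis of $\Lambda^{1,0}$; it is a volume form if $c>0$. A $(q,0)$-form is simple if it is of the form $\mu_1\wedge\dots\wedge\mu_q$ with $\mu_j\in\Lambda^{1,0}$. A $(k,k)$-form $\Omega$ is transverse if for every non-zero simple $(n-k,0)$-form $\psi$ the $(n,n)$-form $i^{(n-k)^2}\,\Omega\wedge\psi\wedge\bar\psi$ is a volume form. A $p$-Kähler structure on a Lie algebra with complex structure $(\mathfrak g,J)$ of complex dimension $n$ ($1\le p<n$) is a real transverse $(p,p)$-form $\Omega$ on $(\mathfrak g,J)$ (a complex vector space via $J$) with $d\Omega=0$. *)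

(* Defs.v *)
From mathcomp Require Import all_boot all_order all_algebra.
From mathcomp Require Import complex reals.

Set Implicit Arguments.
Unset Strict Implicit.
Unset Printing Implicit Defensive.

Import Order.TTheory GRing.Theory Num.Theory.
Local Open Scope ring_scope.
Local Open Scope complex_scope.

Record lie_bracket (R : realType) (g : vectType R) (br : g -> g -> g) : Prop :=
  LieBracket {
    lie_linearl : forall y, linear (br^~ y);
    lie_linearr : forall x, linear (br x);
    lie_alt : forall x, br x x = 0;
    lie_jacobi : forall x y z,
      br x (br y z) + br y (br z x) + br z (br x y) = 0 }.

(* By bilinearity, the brackets of basis vectors span the same subspace as    *)
(* all brackets of an element of g with one of lower_central br k'.           *)
Fixpoint lower_central (R : realType) (g : vectType R) (br : g -> g -> g)
    (k : nat) : {vspace g} :=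
  if k is k'.+1 then
    <<[seq br x y | x <- vbasis {:g}, y <- vbasis (lower_central br k')]>>%VS
  else {:g}%VS.

Definition lie_nilpotent (R : realType) (g : vectType R) (br : g -> g -> g) :=
  exists k, lower_central br k = 0%VS.

Definition lie_abelian (R : realType) (g : vectType R) (br : g -> g -> g) :=
  forall x y, br x y = 0.

Definition nijenhuis (R : realType) (g : vectType R) (br : g -> g -> g)
    (J : 'End(g)) (x y : g) : g :=
  br (J x) (J y) - J (br (J x) y) - J (br x (J y)) - br x y.

(* J makes V a complex vector space, of dimension cdim V.                     *)
Definition almost_complex (R : realType) (V : vectType R) (J : 'End(V)) :=
  forall x, J (J x) = - x.

Definition complex_structure (R : realType) (g : vectType R)
    (br : g -> g -> g) (J : 'End(g)) :=
  almost_complex J /\ forall x y, nijenhuis br J x y = 0.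

Definition cdim (R : realType) (V : vectType R) : nat := (\dim {:V})./2.

(* Complex-valued forms of all degrees on V at once: the value of a k-form    *)
(* on (v_1, ..., v_k) is its value at the sequence [:: v_1; ...; v_k], and a  *)
(* k-form vanishes on the sequences whose length is not k. The type does not  *)
(* impose this, nor multilinearity and alternation: they follow from pq_form  *)
(* and simple_form below, whose elements are generated by covectors.          *)
Definition extform (R : realType) (V : vectType R) := seq V -> R[i].

Definition cov (R : realType) (V : vectType R) (a : V -> R[i]) : extform V :=
  fun s => if s is [:: x] then a x else 0.

Definition unit_form (R : realType) (V : vectType R) : extform V :=
  fun s => (s == [::])%:R.

Definition conj_form (R : realType) (V : vectType R) (f : extform V) :
  extform V := fun s => (f s)^*.

Definition scale_form (R : realType) (V : vectType R) (c : R[i])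
    (f : extform V) : extform V := fun s => c * f s.

(* The entries of s at the positions in A, in increasing order of position.   *)
Definition subword (T : Type) (s : seq T) (A : {set 'I_(size s)}) : seq T :=
  [seq tnth (in_tuple s) i | i <- enum A].

(* The exterior product as a sum over shuffles (no factorials): A is the set  *)
(* of the positions that go to f, and the exponent is the number of           *)
(* inversions of the shuffle that lists A and then its complement.            *)
Definition wedge (R : realType) (V : vectType R) (f h : extform V) :
    extform V :=
  fun s => \sum_(A : {set 'I_(size s)})
    (-1) ^+ #|[set ij : 'I_(size s) * 'I_(size s) |
               [&& (ij.1 < ij.2)%N, ij.1 \notin A & ij.2 \in A]]|
    * f (subword A) * h (subword (~: A)).

(* The Chevalley-Eilenberg differential (trivial coefficients); positions are *)
(* counted from 0, which does not change the parity of i + j.                 *)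
Definition ce_diff (R : realType) (g : vectType R) (br : g -> g -> g)
    (f : extform g) : extform g :=
  fun s => \sum_(i < size s) \sum_(j < size s | (i < j)%N)
    (-1) ^+ (i + j) *
    f (br (tnth (in_tuple s) i) (tnth (in_tuple s) j)
         :: subword (~: [set i; j])).

Definition covector10 (R : realType) (V : vectType R) (J : 'End(V))
    (a : V -> R[i]) : Prop :=
  (forall (r : R) x y, a (r *: x + y) = r%:C * a x + a y) /\
  (forall x, a (J x) = 'i%C * a x).

Definition basis10 (R : realType) (V : vectType R) (J : 'End(V)) (n : nat)
    (a : 'I_n -> V -> R[i]) : Prop :=
  (forall j, covector10 J (a j)) /\
  (forall b, covector10 J b ->
     exists! c : 'rV[R[i]]_n, forall x, b x = \sum_(j < n) c 0 j * a j x).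

(* Lambda^{p,q} is the complex span of the products of p covectors of type    *)
(* (1,0) and q conjugates of such covectors.                                  *)
Definition pq_form (R : realType) (V : vectType R) (J : 'End(V)) (p q : nat)
    (f : extform V) : Prop :=
  exists (m : nat) (c : 'I_m -> R[i])
         (a : 'I_m -> 'I_p -> V -> R[i]) (b : 'I_m -> 'I_q -> V -> R[i]),
    [/\ forall k i, covector10 J (a k i),
        forall k j, covector10 J (b k j) &
        f =1 fun s => \sum_(k < m) c k *
          wedge (\big[@wedge R V/@unit_form R V]_(i < p) cov (a k i))
                (\big[@wedge R V/@unit_form R V]_(j < q)
                    conj_form (cov (b k j))) s].

Definition simple_form (R : realType) (V : vectType R) (J : 'End(V)) (q : nat)
    (f : extform V) : Prop :=
  exists a : 'I_q -> V -> R[i], (forall j, covector10 J (a j)) /\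
    f =1 \big[@wedge R V/@unit_form R V]_(j < q) cov (a j).

Definition volume_form (R : realType) (V : vectType R) (J : 'End(V))
    (f : extform V) : Prop :=
  exists (c : R) (a : 'I_(cdim V) -> V -> R[i]),
    [/\ 0 < c, basis10 J a &
        f =1 scale_form c%:C
          (\big[@wedge R V/@unit_form R V]_(j < cdim V)
             scale_form 'i%C (wedge (cov (a j)) (conj_form (cov (a j)))))].

Definition transverse (R : realType) (V : vectType R) (J : 'End(V)) (k : nat)
    (f : extform V) : Prop :=
  pq_form J k k f /\
  forall h : extform V, simple_form J (cdim V - k) h -> (exists s, h s != 0) ->
    volume_form J
      (scale_form ('i%C ^+ ((cdim V - k) ^ 2)%N)
         (wedge (wedge f h) (conj_form h))).

Definition real_form (R : realType) (V : vectType R) (f : extform V) :=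
  conj_form f =1 f.

Definition p_kahler (R : realType) (g : vectType R) (br : g -> g -> g)
    (J : 'End(g)) (p : nat) (f : extform g) : Prop :=
  [/\ (1 <= p < cdim g)%N, real_form f, transverse J p f &
      forall s, ce_diff br f s = 0].

(* Main.v *)
From HB Require Import structures.
Require Import Defs.
From mathcomp Require Import all_boot all_order all_algebra.
From mathcomp Require Import complex reals boolp.
From mathcomp Require Import ring lra zify.

Set Implicit Arguments.
Unset Strict Implicit.
Unset Printing Implicit Defensive.

Import Order.TTheory GRing.Theory Num.Theory.
Local Open Scope ring_scope.

(** Why a nilpotent Lie algebra [g] of real dimension 8 with a complex structure
[J] and a closed transverse (2,2)-form Omega is abelian.

Only four properties of T = Re Omega are used ([kahler_form]): it is
alternating and 4-linear in real vectors, T x (J x) is J-invariant in the two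
other slots, T x (J x) y (J y) is nonzero when x and y are independent over the
complex numbers, and dT = 0. So, for x <> 0, the slice F = T x (J x) behaves
like the fundamental form of a Hermitian metric, up to sign, on the quotient of
[g] by the complex line of x.

Engel's theorem provides a central vector C <> 0. Integrability makes
D = ad (J C) commute with J, and nilpotency keeps C out of the image of D.
Engel's theorem applied to D on its own image then bounds the complex rank of D
by 2, and by 1 modulo a central complex line ([dim_adIm]).
Another consequence of Engel's theorem and of the Nijenhuis identity is that a
subspace closed under J which normalizes a complex line centralizes it
([Jline_normalizer]).

If some complex line <C, J C> is central, the slice of T at C is a closed form
on g / <C, J C>, and a nilpotent algebra with a Kahler form is abelian
([quotient_abelian]). So [g, g] lies in <C, J C>, and dT = 0 says that the two
coefficients lam of the bracket satisfy lam /\ F = 0 on a space of real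
dimension 6, where the exterior product with F is injective on 2-forms. Hence
[g] is abelian ([central_line_abelian]).

Otherwise no J-stable ideal is a complex line ([no_line_ideal]), while D has
complex rank 1 or 2. Rank 2 leads to such an ideal ([adIm_rank2_false]). In
rank 1, write E = D W for a spanning vector E of the image and h = [W, J E].
If h = 0, the vector [W, E] is central and nonzero, dT = 0 first makes it a
multiple of C ([u_line]) and then gives F K (J K) = 0 for a suitable K outside
<C, J C> ([mixed_eq0_false]). If h <> 0, then h is independent from C and E
over the complex numbers; an element s of the second centre has, for a good
choice of W, the form E + a h + b J h + c C, which makes h an eigenvector of
some ad m modulo C for a nonzero eigenvalue
([second_center_normal_form_false]).

Conversely, every form on an abelian algebra is closed, and the square of a
flat Kahler form is transverse ([flat_transverse]).

The exterior product is handled through the recursion [wedge_cons], the fact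
that interior products are antiderivations. Transversality is compared with
values of T through the uniqueness of an alternating form of top degree
([multialt_basis_eq0]): on a frame x, y, u, v adapted to a simple form with
kernel <x, y>, the 8-form in the definition of transversality is a multiple of
T x (J x) y (J y). *)

(** * Complex lines and J-stable subspaces *)

Section JLinear.
Variables (R : realType) (V : vectType R).

(** Vector identities are closed by passing to coordinates, where they become
    ring identities between scalars. *)
Lemma coord_ext (x y : V) :
  (forall i, coord (vbasis {:V}) i x = coord (vbasis {:V}) i y) -> x = y.
Proof.
move=> H; rewrite (coord_vbasis (memvf x)) (coord_vbasis (memvf y)).
by apply: eq_bigr => i _; rewrite H.
Qed.

Lemma mem_addvl (U W : {vspace V}) x : x \in U -> x \in (U + W)%VS.
Proof. exact: subvP (addvSl U W) x. Qed.

Lemma mem_addvr (U W : {vspace V}) x : x \in W -> x \in (U + W)%VS.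
Proof. exact: subvP (addvSr U W) x. Qed.

Variable J : 'End(V).
Hypothesis JJ : almost_complex J.

Definition Jstable (U : {vspace V}) := forall x, x \in U -> J x \in U.
Definition Jline (x : V) : {vspace V} := (<[x]> + <[J x]>)%VS.

Lemma memv_addJline (U : {vspace V}) x v :
  v \in (U + Jline x)%VS <->
  exists u a b, u \in U /\ v = u + (a *: x + b *: J x).
Proof.
split=> [/memv_addP[u Uu [w /memv_addP[p /vlineP[a ->] [q /vlineP[b ->] ->]] ->]]|].
  by exists u, a, b.
move=> [u [a [b [Uu ->]]]]; apply: memv_add => //.
by apply: memv_add; apply/vlineP; [exists a|exists b].
Qed.

Lemma mem_Jline x v :
  v \in Jline x <-> exists a b, v = a *: x + b *: J x.
Proof.
split=> [/memv_addP[p /vlineP[a ->] [q /vlineP[b ->] ->]]|[a [b ->]]].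
  by exists a, b.
by apply: memv_add; apply/vlineP; [exists a|exists b].
Qed.

Lemma Jline_id x : x \in Jline x.
Proof. by apply/mem_Jline; exists 1, 0; rewrite scale1r scale0r addr0. Qed.

Lemma Jline_J x : J x \in Jline x.
Proof. by apply/mem_Jline; exists 0, 1; rewrite scale1r scale0r add0r. Qed.

Lemma Jstable0 : Jstable 0%VS.
Proof. by move=> x; rewrite !memv0 => /eqP ->; rewrite linear0. Qed.

Lemma Jstable_line x : Jstable (Jline x).
Proof.
move=> v /mem_Jline[a [b ->]]; rewrite linearD !linearZ /= JJ.
apply/mem_Jline; exists (- b), a.
by rewrite scalerN scaleNr addrC.
Qed.

Lemma Jstable_add U W : Jstable U -> Jstable W -> Jstable (U + W)%VS.
Proof.
move=> hU hW v /memv_addP[u Uu [w Ww ->]]; rewrite linearD.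
by apply: memv_add; [apply: hU|apply: hW].
Qed.

Lemma Jstable_sub U x : Jstable U -> x \in U -> (Jline x <= U)%VS.
Proof.
by move=> hU Ux; rewrite subv_add -!memvE Ux hU.
Qed.

(** The vector a x + b J x is x times the complex number a + i b, which is
    invertible unless it is 0. *)
Lemma Jstable_unit U a b x : Jstable U -> a *: x + b *: J x \in U ->
  x \notin U -> a = 0 /\ b = 0.
Proof.
move=> hU h hx.
have h2 := hU _ h; rewrite linearD !linearZ /= JJ in h2.
have: a *: (a *: x + b *: J x) - b *: (a *: J x + b *: (- x)) \in U.
  by rewrite memvB // memvZ.
have -> : a *: (a *: x + b *: J x) - b *: (a *: J x + b *: (- x)) =
   (a ^+ 2 + b ^+ 2) *: x.
  by apply: coord_ext => i; rewrite !(linearD,linearZ,linearN) /=; ring.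
have [/eqP|nz] := eqVneq (a ^+ 2 + b ^+ 2) 0; last first.
  move=> /(memvZ (a ^+ 2 + b ^+ 2)^-1).
  by rewrite scalerA mulVf // scale1r (negPf hx).
by rewrite paddr_eq0 ?sqr_ge0 // !sqrf_eq0 => /andP[/eqP -> /eqP ->].
Qed.

Lemma dim_addJline U x : Jstable U -> x \notin U ->
  \dim (U + Jline x) = (\dim U).+2.
Proof.
move=> hU hx.
have dx : \dim (Jline x) = 2%N.
  apply/eqP; rewrite eqn_leq; apply/andP; split.
    by apply: leq_trans (dimv_add_leqif _ _) _; rewrite !dim_vline; do 2 case: (_ == _).
  have : free [:: x; J x].
    rewrite free_cons seq1_free span_seq1.
    apply/andP; split; last first.
      apply/eqP => h; have := JJ x; rewrite h linear0 => /eqP.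
      rewrite eq_sym oppr_eq0 => /eqP x0; by rewrite x0 mem0v in hx.
    apply/vlineP => -[k hk].
    have : (1 *: x + (- k) *: J x) \in U.
      by rewrite {1}hk scale1r scaleNr subrr mem0v.
    by case/(Jstable_unit hU) => // /eqP; rewrite oner_eq0.
  rewrite /free => /eqP; rewrite /= => <-.
  by rewrite span_cons span_seq1.
rewrite dimv_disjoint_sum ?dx ?addn2 //.
apply/eqP; rewrite -subv0; apply/subvP => v; rewrite memv_cap => /andP[hv].
move=> /mem_Jline[a [b e]]; move: hv; rewrite e.
by case/(Jstable_unit hU) => // -> ->; rewrite !scale0r addr0 mem0v.
Qed.

Lemma dim_Jline x : x != 0 -> \dim (Jline x) = 2%N.
Proof.
by move=> x0; have := dim_addJline Jstable0 (x := x);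
  rewrite memv0 dimv0 add0v; apply.
Qed.

Lemma sub_addJline_dim U W x : Jstable U -> x \notin U -> (U <= W)%VS ->
  Jstable W -> x \in W -> \dim W = (\dim U).+2 -> W = (U + Jline x)%VS.
Proof.
move=> hU hx UW hW Wx hd; apply/eqP; rewrite eq_sym eqEdim subv_add UW.
by rewrite Jstable_sub //= dim_addJline // hd.
Qed.

Lemma addJline_subset U W x : Jstable U -> Jstable W -> (U <= W)%VS ->
  x \in W -> x \notin U -> ((\dim U).+2 <= \dim W)%N.
Proof.
move=> hU hW UW Wx Ux; rewrite -(dim_addJline hU Ux); apply: dimvS.
by rewrite subv_add UW Jstable_sub.
Qed.

(** Steinitz exchange, one complex line at a time. *)
Lemma addJline_exchange U x y a b : Jstable U -> y \notin U ->
  y - (a *: x + b *: J x) \in U -> (U + Jline x = U + Jline y)%VS.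
Proof.
move=> hU hy h.
have [/eqP|nz] := eqVneq (a ^+ 2 + b ^+ 2) 0.
  rewrite paddr_eq0 ?sqr_ge0 // !sqrf_eq0 => /andP[/eqP a0 /eqP b0].
  by move: h; rewrite a0 b0 !scale0r addr0 subr0 (negPf hy).
apply/eqP; rewrite eqEsubv; apply/andP; split; rewrite subv_add addvSl /=.
  apply: Jstable_sub; first by apply: Jstable_add => //; apply: Jstable_line.
  set u := y - _ in h.
  have e : x = (a ^+ 2 + b ^+ 2)^-1 *:
      (- (a *: u - b *: J u) + (a *: y + (- b) *: J y)).
    apply: (@scalerI _ _ (a ^+ 2 + b ^+ 2)) => //.
    rewrite scalerA mulfV // scale1r /u !(linearB,linearD,linearZ) /= !JJ.
    by apply: coord_ext => i; rewrite !(linearD,linearZ,linearN) /=; ring.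
  rewrite e; apply: memvZ; apply: memv_add.
    by rewrite memvN memvB // memvZ ?hU.
  by apply/mem_Jline; exists a, (- b).
apply: Jstable_sub; first by apply: Jstable_add => //; apply: Jstable_line.
rewrite -(subrK (a *: x + b *: J x) y); apply: memv_add => //.
by apply/mem_Jline; exists a, b.
Qed.

End JLinear.

(** * Nilpotent Lie algebras *)

Section Nilpotent.
Variables (R : realType) (g : vectType R) (br : g -> g -> g).
Hypothesis hbr : lie_bracket br.

Lemma brDl x y z : br (x + y) z = br x z + br y z.
Proof. by have := lie_linearl hbr z 1 x y; rewrite !scale1r. Qed.
Lemma brDr x y z : br x (y + z) = br x y + br x z.
Proof. by have := lie_linearr hbr x 1 y z; rewrite !scale1r. Qed.
Lemma br0l x : br 0 x = 0.
Proof. by apply: (addrI (br 0 x)); rewrite -brDl !addr0. Qed.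
Lemma br0r x : br x 0 = 0.
Proof. by apply: (addrI (br x 0)); rewrite -brDr !addr0. Qed.
Lemma brZl a x y : br (a *: x) y = a *: br x y.
Proof. by have := lie_linearl hbr y a x 0; rewrite !addr0 br0l addr0. Qed.
Lemma brZr a x y : br x (a *: y) = a *: br x y.
Proof. by have := lie_linearr hbr x a y 0; rewrite !addr0 br0r addr0. Qed.
Lemma brNl x y : br (- x) y = - br x y.
Proof. by rewrite -scaleN1r brZl scaleN1r. Qed.
Lemma brNr x y : br x (- y) = - br x y.
Proof. by rewrite -scaleN1r brZr scaleN1r. Qed.
Lemma brxx x : br x x = 0. Proof. exact: lie_alt hbr x. Qed.
Lemma brC x y : br x y = - br y x.
Proof.
have := brxx (x + y); rewrite brDl !brDr !brxx add0r addr0 => /eqP.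
by rewrite addr_eq0 => /eqP.
Qed.
Lemma br_der x y z : br x (br y z) = br (br x y) z + br y (br x z).
Proof.
have := lie_jacobi hbr x y z; rewrite (brC z (br x y)) (brC z x) brNr => /eqP.
by rewrite subr_eq0 => /eqP <-; rewrite subrK.
Qed.
Definition brE := (brDl, brDr, brZl, brZr, brNl, brNr, br0l, br0r).

Lemma br_sumr (I : Type) (r : seq I) (P : pred I) (F : I -> g) x :
  br x (\sum_(i <- r | P i) F i) = \sum_(i <- r | P i) br x (F i).
Proof. by elim/big_rec2: _ => [|i u v _ <-]; rewrite ?br0r ?brDr. Qed.
Lemma br_suml (I : Type) (r : seq I) (P : pred I) (F : I -> g) x :
  br (\sum_(i <- r | P i) F i) x = \sum_(i <- r | P i) br (F i) x.
Proof. by elim/big_rec2: _ => [|i u v _ <-]; rewrite ?br0l ?brDl. Qed.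

Definition br_span (U : {vspace g}) : {vspace g} :=
  <<[seq br x y | x <- vbasis {:g}, y <- vbasis U]>>%VS.

Lemma mem_br_span (U : {vspace g}) x y : y \in U -> br x y \in br_span U.
Proof.
move=> Uy; rewrite (coord_vbasis Uy) (coord_vbasis (memvf x)).
rewrite br_sumr; apply: memv_suml => i _; rewrite brZr; apply: memvZ.
rewrite br_suml; apply: memv_suml => j _; rewrite brZl; apply: memvZ.
by apply: memv_span; apply: allpairs_f; apply: mem_nth; rewrite size_tuple.
Qed.

Lemma br_span_sub (U W : {vspace g}) : (forall x y, y \in U -> br x y \in W) ->
  (br_span U <= W)%VS.
Proof.
move=> h; apply/span_subvP => v /allpairsP[[x y] /= [_ yU ->]].
by apply: h; apply: vbasis_mem.
Qed.

Hypothesis hnil : lie_nilpotent br.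

(** The common mechanism of all uses of Engel's theorem: take the last stage
    of the filtration whose intersection with S is not inside I, and a vector
    of this intersection outside I. *)
Lemma filtration_common_kernel (G : nat -> {vspace g}) (M : (g -> g) -> Prop)
    (N : nat) (S I : {vspace g}) :
    G 0%N = {:g}%VS -> G N = 0%VS ->
    (forall phi, M phi -> forall k x, x \in G k -> phi x \in G k.+1) ->
    (forall phi, M phi -> forall x, x \in S -> phi x \in S) ->
    ~~ (S <= I)%VS ->
  exists s, [/\ s \in S, s \notin I & forall phi, M phi -> phi s \in I].
Proof.
move=> G0 GN Gstep MS SI.
have ex : exists k, (S :&: G k <= I)%VS.
  by exists N; rewrite GN capv0 sub0v.
case: (ex_minnP ex) => -[|k] hk hmin.
  by move: hk; rewrite G0 capvf (negPf SI).
have /subvPn[s] : ~~ (S :&: G k <= I)%VS.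
  by apply/negP => /hmin; rewrite ltnn.
rewrite memv_cap => /andP[Ss Gs] sI; exists s; split=> // phi Mphi.
by apply: (subvP hk); rewrite memv_cap MS //= Gstep.
Qed.

(** Every ad raises the lower central series. *)
Lemma engel (M : g -> Prop) (S I : {vspace g}) :
    (forall m x, M m -> x \in S -> br m x \in S) -> ~~ (S <= I)%VS ->
  exists s, [/\ s \in S, s \notin I & forall m, M m -> br m s \in I].
Proof.
move=> MS SI; case: hnil => N hN.
have [||s [Ss sI h]] := @filtration_common_kernel (lower_central br)
  (fun phi => exists2 m, M m & phi = br m) N S I erefl hN _ _ SI.
- by move=> _ [m _ ->] k x; apply: mem_br_span.
- by move=> _ [m Mm ->] x; apply: MS.
by exists s; split=> // m Mm; apply: h; exists m.
Qed.

(** A nilpotent operator has no nonzero eigenvalue, and this passes to a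
    quotient by an invariant subspace. *)
Lemma nil_eigenvalue (I : {vspace g}) m v b :
    (forall x, x \in I -> br m x \in I) ->
    br m v - b *: v \in I -> b != 0 -> v \in I.
Proof.
move=> mI h nb; apply/negP => /negP vI.
have [||s [/memv_addP[u /vlineP[c ->] [i Ii es]] sI /(_ m erefl)]] :=
    @engel (fun m' => m' = m) (<[v]> + I)%VS I.
- move=> _ x -> /memv_addP[u /vlineP[c ->] [i Ii ->]]; rewrite brDr brZr.
  have -> : c *: br m v + br m i = (c * b) *: v + (c *: (br m v - b *: v) + br m i).
    by apply: coord_ext => k; rewrite !(linearD,linearZ,linearN) /=; ring.
  apply: memv_add; first by apply/vlineP; exists (c * b).
  by rewrite memvD ?memvZ ?mI.
- by apply/negP => h'; case/negP: vI; apply: (subvP h');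
    rewrite (subvP (addvSl _ _)) // memv_line.
have nc : c != 0.
  by apply/eqP => c0; move: sI; rewrite es c0 scale0r add0r Ii.
rewrite es brDr brZr => h2; case/negP: vI.
have h3 : (c * b) *: v \in I.
  have -> : (c * b) *: v = c *: br m v + br m i - c *: (br m v - b *: v) - br m i.
    by apply: coord_ext => k; rewrite !(linearD,linearZ,linearN) /=; ring.
  by rewrite memvB ?mI // memvB // memvZ.
have := memvZ (c * b)^-1 h3.
by rewrite scalerA mulVf ?scale1r // mulf_neq0.
Qed.

End Nilpotent.

(** * Nilpotency and the complex structure *)

Section NilpotentComplex.
Variables (R : realType) (g : vectType R) (br : g -> g -> g) (J : 'End(g)).
Hypothesis hbr : lie_bracket br.
Hypothesis hnil : lie_nilpotent br.
Hypothesis hJ : complex_structure br J.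

Let JJ : almost_complex J := hJ.1.
Local Notation Jline := (Jline J).
Local Notation Jstable := (Jstable J).

Lemma br_JJ x y :
  br (J x) (J y) = J (br (J x) y) + J (br x (J y)) + br x y.
Proof.
have := hJ.2 x y; rewrite /nijenhuis => e.
apply/eqP; rewrite -subr_eq0 -e; apply/eqP.
by apply: coord_ext => k; rewrite !(linearD,linearZ,linearN) /=; ring.
Qed.

(** Engel's theorem gives s in the complex line with [m, s] = 0 modulo I for
    all m. As 0 is the only eigenvalue, [m, J s] and [J m, J s] are real
    multiples of s. The Nijenhuis identity reduces to [J m, J s] = J [m, J s],
    so the first is also a multiple of J s, and both vanish. *)
Lemma Jline_normalizer (I : {vspace g}) (M : g -> Prop) x :
    Jstable I -> (forall m, M m -> M (J m)) ->
    (forall m y, M m -> y \in I -> br m y \in I) ->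
    (forall m, M m -> br m x \in (I + Jline x)%VS) ->
    (forall m, M m -> br m (J x) \in (I + Jline x)%VS) ->
  forall m y, M m -> y \in (I + Jline x)%VS -> br m y \in I.
Proof.
move=> sI MJ MI Mx MJx.
have MS m y : M m -> y \in (I + Jline x)%VS -> br m y \in (I + Jline x)%VS.
  move=> Mm /memv_addJline[i [a [b [Ii ->]]]]; rewrite !(brE hbr) memvD //.
    by rewrite mem_addvl ?MI.
  by rewrite memvD // memvZ ?Mx ?MJx.
have [/subvP Sx|] := boolP (I + Jline x <= I)%VS.
  by move=> m y Mm /Sx; apply: MI.
move=> /(engel hbr hnil MS)[s [Ss sI' Ms]].
have eS : (I + Jline x)%VS = (I + Jline s)%VS.
  case/memv_addJline: (Ss) => i [a [b [Ii es]]].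
  by apply: (addJline_exchange JJ (a := a) (b := b)) => //; rewrite es addrK.
have key m : M m -> exists a, br m (J s) - a *: s \in I.
  move=> Mm; have : br m (J s) \in (I + Jline s)%VS.
    by rewrite -eS; apply: MS; rewrite // eS mem_addvr // Jline_J.
  case/memv_addJline=> i [a [b [Ii e]]]; exists a.
  have [b0|nb] := eqVneq b 0.
    by rewrite e b0 scale0r addr0 addrK.
  have : a *: s + b *: J s \in I.
    apply: (nil_eigenvalue hbr hnil (m := m) (b := b)) => // [y|].
      exact: MI.
    rewrite !(brE hbr) e.
    have -> : a *: br m s + b *: (i + (a *: s + b *: J s)) -
        b *: (a *: s + b *: J s) = a *: br m s + b *: i.
      by apply: coord_ext => k; rewrite !(linearD,linearZ,linearN) /=; ring.
    by rewrite memvD // memvZ // Ms.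
  by case/(Jstable_unit JJ sI) => // _ b0; rewrite b0 eqxx in nb.
have MJs m : M m -> br m (J s) \in I.
  move=> Mm; have [a ha] := key _ Mm; have [b hb] := key _ (MJ _ Mm).
  have : a *: J s + (- b) *: s \in I.
    have -> : a *: J s + - b *: s = (br (J m) (J s) - b *: s) -
       J (br (J m) s) - J (br m (J s) - a *: s) - br m s.
      rewrite br_JJ !linearB !linearZ /=.
      by apply: coord_ext => k; rewrite !(linearD,linearZ,linearN) /=; ring.
    rewrite memvB ?Ms // memvB ?sI // memvB // sI // Ms //; exact: MJ.
  rewrite addrC; case/(Jstable_unit JJ sI) => // _ a0.
  by move: ha; rewrite a0 scale0r subr0.
move=> m y Mm; rewrite eS => /memv_addJline[i [a [b [Ii ->]]]].
rewrite !(brE hbr) memvD ?MI // memvD // memvZ ?Ms ?MJs //.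
Qed.

(** The (1,0) part of ad: [W - i J W, y - i J y] = z - i J z where z = [brQ W
    y]. It is linear over the complex numbers and nilpotent, although ad W
    alone need not commute with J. *)
Definition brQ W y : g := br W y - br (J W) (J y).

Lemma brQ_J W y : brQ W (J y) = J (brQ W y).
Proof.
have := br_JJ W (J y); rewrite JJ !(brE hbr) linearN /= => h.
rewrite /brQ JJ !(brE hbr) linearB /= -[br (J W) y]opprK h.
by apply: coord_ext => k; rewrite !(linearD,linearZ,linearN) /=; ring.
Qed.

Lemma brQD W x y : brQ W (x + y) = brQ W x + brQ W y.
Proof.
rewrite /brQ linearD !(brE hbr).
by apply: coord_ext => k; rewrite !(linearD,linearZ,linearN) /=; ring.
Qed.

Lemma brQZ W a x : brQ W (a *: x) = a *: brQ W x.
Proof. by rewrite /brQ linearZ !(brE hbr) scalerBr. Qed.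

(** The vectors y such that y and J y lie in the k-th term of the lower
    central series form a filtration raised by [brQ W]. *)
Lemma brQ_kernel W (S : {vspace g}) :
  (forall y, y \in S -> brQ W y \in S) -> S != 0%VS ->
  exists s, [/\ s \in S, s != 0 & brQ W s = 0].
Proof.
move=> QS S0; case: (hnil) => N hN.
pose G k := (lower_central br k :&: J @^-1: lower_central br k)%VS.
have [||_ ->|_ -> y /QS //||s [Ss s0 h]] :=
  @filtration_common_kernel _ _ G (fun phi => phi = brQ W) N S 0%VS.
- by apply/vspaceP => x; rewrite memv_cap -memv_preim !memvf.
- by rewrite /G hN cap0v.
- move=> k y; rewrite !memv_cap -!memv_preim => /andP[h1 h2].
  apply/andP; split.
    by rewrite /brQ memvB // mem_br_span.
  by rewrite -brQ_J /brQ JJ memvB // mem_br_span // memvN.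
- by rewrite subv0.
exists s; split=> //; first by rewrite -memv0.
by apply/eqP; rewrite -memv0 h.
Qed.

Lemma brQ_chain0 W v : brQ W v \in Jline v -> brQ W v = 0.
Proof.
move=> h; have [->|v0] := eqVneq v 0.
  by rewrite -[0](scale0r (0 : g)) brQZ !scale0r.
have [||s [/mem_Jline[a [b ->]] s0]] := @brQ_kernel W (Jline v).
- move=> y /mem_Jline[a [b ->]]; rewrite brQD !brQZ brQ_J memvD // memvZ //.
  exact: Jstable_line.
- by apply/eqP => e; have := Jline_id J v; rewrite e memv0 (negPf v0).
rewrite brQD !brQZ brQ_J => e.
apply/eqP/negPn/negP; rewrite -memv0 => /(Jstable_unit JJ (@Jstable0 _ _ J)).
case/(_ a b) => [|a0 b0]; first by rewrite e mem0v.
by move: s0; rewrite a0 b0 !scale0r addr0 eqxx.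
Qed.

(** A nilpotent operator with Q v0 = v1 that preserves the complex span of v0
    and v1 is a Jordan block, so it kills v1. The next lemma is the same
    statement for three vectors. *)
Lemma brQ_chain1 W v0 v1 : brQ W v0 = v1 ->
  brQ W v1 \in (Jline v0 + Jline v1)%VS -> brQ W v1 = 0.
Proof.
move=> e1 h; have [v10|v10] := eqVneq v1 0.
  by apply: brQ_chain0; rewrite v10 -[0](scale0r (0 : g)) brQZ !scale0r mem0v.
have sv := @Jstable_line _ _ J JJ.
have [||s [/memv_addJline[p [a [b [/mem_Jline[c [d ->]] ->]]]] s0]] :=
   @brQ_kernel W (Jline v0 + Jline v1)%VS.
- move=> y /memv_addJline[p [a [b [/mem_Jline[c [d ->]] ->]]]].
  rewrite !(brQD,brQZ,brQ_J) e1.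
  apply: memvD; first by rewrite mem_addvr // memvD // memvZ ?Jline_id ?Jline_J.
  by rewrite memvD // memvZ //; apply: (Jstable_add (sv v0) (sv v1)).
- apply/eqP => e; have : v1 \in (Jline v0 + Jline v1)%VS.
    by rewrite mem_addvr // Jline_id.
  by rewrite e memv0 (negPf v10).
rewrite !(brQD,brQZ,brQ_J) e1 => e.
apply: brQ_chain0; apply/negPn/negP => /(Jstable_unit JJ (sv v1)).
case/(_ a b) => [|a0 b0].
  rewrite -memvN -sub0r -e addrK; apply/mem_Jline; exists c, d => //.
move: e s0; rewrite a0 b0 !scale0r !addr0 => e.
have [||c0 d0] := Jstable_unit JJ (@Jstable0 _ _ J) (a := c) (b := d) (x := v1).
- by rewrite e mem0v.
- by rewrite memv0.
by rewrite c0 d0 !scale0r addr0 eqxx.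
Qed.

Lemma brQ_chain2 W v0 v1 v2 : brQ W v0 = v1 -> brQ W v1 = v2 ->
  brQ W v2 \in (Jline v0 + Jline v1 + Jline v2)%VS -> brQ W v2 = 0.
Proof.
move=> e1 e2 h.
have [v10|v10] := eqVneq v1 0.
  by rewrite -e2 v10 -[0](scale0r (0 : g)) !(brQZ,scale0r).
have [v21|v21] := boolP (v2 \in Jline v1).
  have v20 : v2 = 0 by rewrite -e2; apply: brQ_chain0; rewrite e2.
  by rewrite v20 -[0](scale0r (0 : g)) !(brQZ,scale0r).
have sv := @Jstable_line _ _ J JJ.
have [||s [/memv_addJline[p [a [b [/memv_addJline[q [a' [b' [/mem_Jline[c [d ->]] ->]]]] ->]]]] s0]] :=
   @brQ_kernel W (Jline v0 + Jline v1 + Jline v2)%VS.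
- move=> y /memv_addJline[p [a [b [/memv_addJline[q [a' [b' [/mem_Jline[c [d ->]] ->]]]] ->]]]].
  rewrite !(brQD,brQZ,brQ_J) e1 e2.
  apply: memvD; first apply: memvD.
  + rewrite mem_addvl // mem_addvr // memvD // memvZ //.
      exact: Jline_id.
    exact: Jline_J.
  + by rewrite mem_addvr // memvD // memvZ ?Jline_id ?Jline_J.
  by rewrite memvD // memvZ //; apply: (Jstable_add (Jstable_add (sv v0) (sv v1)) (sv v2)).
- apply/eqP => e; have : v1 \in (Jline v0 + Jline v1 + Jline v2)%VS.
    by rewrite mem_addvl // mem_addvr // Jline_id.
  by rewrite e memv0 (negPf v10).
rewrite !(brQD,brQZ,brQ_J) e1 e2 => e.
apply: (brQ_chain1 e2); apply/negPn/negP.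
move=> /(Jstable_unit JJ (Jstable_add (sv v1) (sv v2))).
case/(_ a b) => [|a0 b0].
  rewrite -memvN -sub0r -e addrK memv_add //.
    by apply/mem_Jline; exists c, d.
  by apply/mem_Jline; exists a', b'.
move: e s0; rewrite a0 b0 !scale0r !addr0 => e.
have [||a'0 b'0] := Jstable_unit JJ (sv v1) (a := a') (b := b') (x := v2).
- rewrite -memvN -sub0r -e addrK; apply/mem_Jline; exists c, d => //.
- by [].
move: e; rewrite a'0 b'0 !scale0r !addr0 => e.
have [||c0 d0] := Jstable_unit JJ (@Jstable0 _ _ J) (a := c) (b := d) (x := v1).
- by rewrite e mem0v.
- by rewrite memv0.
by rewrite c0 d0 !scale0r addr0 eqxx.
Qed.

End NilpotentComplex.

(** * The operator ad (J X) modulo a central subspace *)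

Section AdJ.
Variables (R : realType) (g : vectType R) (br : g -> g -> g) (J : 'End(g)).
Hypothesis hbr : lie_bracket br.
Hypothesis hnil : lie_nilpotent br.
Hypothesis hJ : complex_structure br J.

Let JJ : almost_complex J := hJ.1.
Local Notation Jline := (Jline J).
Local Notation Jstable := (Jstable J).

Definition adv (x : g) : 'End(g) := linfun (br x).

Lemma advE x y : adv x y = br x y.
Proof.
pose f : {linear g -> g} :=
  HB.pack (br x) (GRing.isLinear.Build _ _ _ _ (br x) (lie_linearr hbr x)).
by rewrite /adv (lfunE f).
Qed.

Variables (I : {vspace g}) (X : g).
Hypothesis sI : Jstable I.
Hypothesis cI : forall x i, i \in I -> br x i = 0.
Hypothesis XI : X \notin I.
Hypothesis brX : forall x, br x X \in I.

Let D := adv (J X).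
(** Together with [adKer], the image and the kernel of ad (J X) on g / I,
    pulled back to g. *)
Definition adIm : {vspace g} := (limg D + I)%VS.
Definition adKer : {vspace g} := (D @^-1: I)%VS.

Lemma central_brl x i : i \in I -> br i x = 0.
Proof. by move=> Ii; rewrite (brC hbr) cI ?oppr0. Qed.

Lemma adKerE y : (y \in adKer) = (br (J X) y \in I).
Proof. by rewrite -memv_preim advE. Qed.

Lemma adIm_br y : br (J X) y \in adIm.
Proof. by rewrite mem_addvl // -advE memv_img ?memvf. Qed.

Lemma I_adIm i : i \in I -> i \in adIm.
Proof. exact: mem_addvr. Qed.

Lemma I_adKer i : i \in I -> i \in adKer.
Proof. by move=> Ii; rewrite adKerE cI // mem0v. Qed.

(** As X is central modulo I, integrability says that ad (J X) commutes with J
    on g / I. *)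
Lemma ad_J y : br (J X) (J y) - J (br (J X) y) \in I.
Proof.
have -> : br (J X) (J y) - J (br (J X) y) = - (J (br (J y) X) + br y X).
  rewrite (br_JJ hJ X y) (brC hbr X y) (brC hbr X (J y)) linearN /=.
  by apply: coord_ext => k; rewrite !(linearD,linearN) /=; ring.
by rewrite memvN memvD // sI.
Qed.

Lemma adKer_stable : Jstable adKer.
Proof.
move=> y; rewrite !adKerE => h.
by rewrite -(subrK (J (br (J X) y)) (br _ _)) memvD ?ad_J // sI.
Qed.

Lemma adIm_stable : Jstable adIm.
Proof.
move=> y /memv_addP[_ /memv_imgP[w _ ->] [i Ii ->]].
rewrite advE linearD /=; apply: memvD; last by rewrite I_adIm ?sI.
rewrite -[J (br _ _)](subKr (br (J X) (J w))) memvB ?adIm_br //.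
exact/I_adIm/ad_J.
Qed.

(** If X = [J X, w] modulo I, then J X = [J X, J w], so J X is an eigenvector
    of ad (J w) modulo I with eigenvalue -1. *)
Lemma X_adIm : X \notin adIm.
Proof.
apply/negP => /memv_addP[_ /memv_imgP[w _ ->] [i Ii]]; rewrite advE => e.
case/negP: XI.
suff : J X \in I by move=> /sI; rewrite JJ memvN.
apply: (nil_eigenvalue hbr hnil (m := J w) (b := -1)).
- by move=> x /(cI (J w)) ->; rewrite mem0v.
- have -> : br (J w) (J X) - -1 *: J X =
     - (br (J X) (J w) - J (br (J X) w)) + J i.
    rewrite (brC hbr (J w)) {2}e linearD /=.
    by apply: coord_ext => k; rewrite !(linearD,linearZ,linearN) /=; ring.
  by rewrite memvD ?memvN ?ad_J ?sI.
- by rewrite oppr_eq0 oner_eq0.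
Qed.

Lemma adKer_X : (I + Jline X <= adKer)%VS.
Proof.
rewrite subv_add; apply/andP; split; first by apply/subvP => i /I_adKer.
apply: Jstable_sub; first exact: adKer_stable.
by rewrite adKerE brX.
Qed.

Lemma dim_adKer_adIm :
  (\dim adKer + \dim adIm = \dim {:g} + \dim I)%N.
Proof.
have := limg_ker_dim D adKer; rewrite /adKer.
have -> : (D @^-1: I :&: lker D = lker D)%VS.
  by apply/capv_idPr/subvP => v; rewrite memv_ker -memv_preim => /eqP ->; rewrite mem0v.
have -> : (D @: (D @^-1: I) = limg D :&: I)%VS.
  apply/vspaceP => v; rewrite memv_cap; apply/memv_imgP/andP.
    by case=> u; rewrite -memv_preim => h ->; rewrite h memv_img ?memvf.
  by case=> /memv_imgP[u _ ->] h; exists u; rewrite -?memv_preim.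
have := limg_ker_dim D {:g}; rewrite capfv.
have := dimv_sum_cap (limg D) I; rewrite /adIm.
lia.
Qed.

(** Engel's theorem for ad (J X) on its own image gives E in the image and in
    the kernel, and E is not on the complex line of X because X avoids the
    image. *)
Lemma adIm_kernel : ~~ (limg D <= I)%VS ->
  exists W E, [/\ E = br (J X) W, E \notin I, br (J X) E \in I &
                  E \notin (I + Jline X)%VS].
Proof.
move=> h.
have [|s [/memv_imgP[w _]]] := @engel _ _ _ hbr hnil (fun m => m = J X) _ _ _ h.
  by move=> _ x -> _; rewrite -advE memv_img ?memvf.
rewrite advE => -> wI /(_ _ erefl) hk; exists w, (br (J X) w); split=> //.
apply/negP => /memv_addJline[i [a [b [Ii e]]]].
have : a *: X + b *: J X \in adIm.
  by rewrite -(addKr i (_ + _)) -e memvD ?memvN ?adIm_br ?I_adIm.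
case/(Jstable_unit JJ adIm_stable); first exact: X_adIm.
move=> a0 b0; move: wI; rewrite e a0 b0 !scale0r !addr0.
by rewrite Ii.
Qed.

(** The kernel of ad (J X) on g / I contains the independent complex lines of
    X and of E, so the rank is at most dim (g / I) - 4. *)
Lemma dim_adIm : ~~ (limg D <= I)%VS ->
  (\dim adIm + 4 <= \dim {:g})%N.
Proof.
move=> /adIm_kernel[W [E [_ _ hE nE]]].
have sX : Jstable (I + Jline X)%VS.
  by apply: Jstable_add => //; apply: Jstable_line.
have := dimvS adKer_X; rewrite (dim_addJline JJ) // => d1.
have EK : E \in adKer by rewrite adKerE.
have := addJline_subset JJ sX adKer_stable adKer_X EK nE.
rewrite (dim_addJline JJ) //; have := dim_adKer_adIm; lia.
Qed.

Section RankOne.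
Variables (W E : g).
Hypothesis hE : E = br (J X) W.
Hypothesis EI : E \notin I.
Hypothesis ImE : adIm = (I + Jline E)%VS.

(** As ad (J X) is a derivation that sends y into the centre, [y, E] = [J X,
    [y, W]] modulo I, which is in the image, that is, in the complex line of
    E. *)
Lemma adKer_Jline y e : y \in adKer -> e \in (I + Jline E)%VS -> br y e \in I.
Proof.
have sK := adKer_stable.
have key y' w : y' \in adKer -> br y' (br (J X) w) \in adIm.
  move=> Ky; have := br_der hbr (J X) y' w.
  rewrite adKerE in Ky; rewrite (central_brl _ Ky) add0r => <-.
  exact: adIm_br.
move=> Ky he; apply: (Jline_normalizer hbr hnil hJ (M := fun m => m \in adKer) (I := I) (x := E)) => //.
- by move=> m i _ /cI ->; rewrite mem0v.
- by move=> m Km; rewrite -ImE hE key.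
- move=> m Km; rewrite -ImE.
  have -> : br m (J E) = br m (br (J X) (J W)).
    apply/eqP; rewrite eq_sym -subr_eq0 -(brNr hbr) -(brDr hbr) hE.
    by rewrite (cI _ (ad_J W)).
  exact: key.
Qed.

Lemma adKer_ideal x y : y \in adKer -> br x y \in adKer.
Proof.
move=> Ky; rewrite adKerE (br_der hbr).
have Ky' := Ky; rewrite adKerE in Ky'; rewrite (cI x Ky') addr0.
rewrite (brC hbr) memvN adKer_Jline // -ImE; exact: adIm_br.
Qed.

Lemma dim_adKer1 : \dim adKer = (\dim {:g} - 2)%N.
Proof.
have := dim_adKer_adIm; rewrite ImE (dim_addJline JJ) //; lia.
Qed.

Lemma W_adKer : W \notin adKer.
Proof. by rewrite adKerE -hE. Qed.

Lemma adKer_span : (adKer + Jline W)%VS = {:g}%VS.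
Proof.
symmetry; apply: (sub_addJline_dim JJ) (subvf _) _ (memvf _) _ => //.
- exact: adKer_stable.
- exact: W_adKer.
- by move=> x _; apply: memvf.
rewrite dim_adKer1; have := dim_adKer_adIm.
rewrite ImE (dim_addJline JJ) //; have := dimvS (subvf I).
have := dimvS (subvf adKer).
have := addJline_subset JJ adKer_stable (fun x _ => memvf (J x)) (subvf _) (memvf W) W_adKer.
lia.
Qed.

(** The complex line g / adKer is normalized by g, hence centralized. *)
Lemma br_adKer x y : br x y \in adKer.
Proof.
apply: (Jline_normalizer hbr hnil hJ (M := fun=> True) (x := W)) => //.
- exact: adKer_stable.
- by move=> m z _; apply: adKer_ideal.
- by move=> m _; rewrite adKer_span memvf.
- by move=> m _; rewrite adKer_span memvf.
by rewrite adKer_span memvf.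
Qed.

End RankOne.
End AdJ.

(** * The real 4-form of a closed transverse (2,2)-form *)

(** What is used of a closed transverse (2,2)-form Omega, with T the real part
    of Omega on four real vectors. The field [kf_J] is the only trace of the
    type (2,2), [kf_neq0] is transversality without its sign, and [kf_closed]
    is the Chevalley-Eilenberg equation dT = 0 on five vectors. *)
Record kahler_form (R : realType) (g : vectType R) (br : g -> g -> g)
    (J : 'End(g)) (T : g -> g -> g -> g -> R) : Prop := KahlerForm {
  kf_lin : forall r a a' b c d, T (r *: a + a') b c d = r * T a b c d + T a' b c d;
  kf_12 : forall a b c d, T a b c d = - T b a c d;
  kf_23 : forall a b c d, T a b c d = - T a c b d;
  kf_34 : forall a b c d, T a b c d = - T a b d c;
  kf_J : forall x y v, T x (J x) (J y) v = - T x (J x) y (J v);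
  kf_neq0 : forall x y, x != 0 -> y \notin Jline J x -> T x (J x) y (J y) != 0;
  kf_closed : forall a b c d e,
    - T (br a b) c d e + T (br a c) b d e - T (br a d) b c e + T (br a e) b c d
    - T (br b c) a d e + T (br b d) a c e - T (br b e) a c d
    - T (br c d) a b e + T (br c e) a b d - T (br d e) a b c = 0 }.

Section KForm.
Variables (R : realType) (g : vectType R) (br : g -> g -> g) (J : 'End(g)).
Variable T : g -> g -> g -> g -> R.
Hypothesis JJ : almost_complex J.
Hypothesis hT : kahler_form br J T.
Local Notation Jline := (Jline J).

Lemma kf1D a a' b c d : T (a + a') b c d = T a b c d + T a' b c d.
Proof. by have := kf_lin hT 1 a a' b c d; rewrite scale1r mul1r. Qed.
Lemma kf10 b c d : T 0 b c d = 0.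
Proof. by apply: (addrI (T 0 b c d)); rewrite -kf1D !addr0. Qed.
Lemma kf1Z r a b c d : T (r *: a) b c d = r * T a b c d.
Proof. by have := kf_lin hT r a 0 b c d; rewrite !addr0 kf10 addr0. Qed.
Lemma kf1N a b c d : T (- a) b c d = - T a b c d.
Proof. by rewrite -scaleN1r kf1Z mulN1r. Qed.
Lemma kf2D a a' b c d : T b (a + a') c d = T b a c d + T b a' c d.
Proof. by rewrite (kf_12 hT) kf1D !(kf_12 hT b) opprD. Qed.
Lemma kf2Z r a b c d : T b (r *: a) c d = r * T b a c d.
Proof. by rewrite (kf_12 hT) kf1Z (kf_12 hT b) mulrN. Qed.
Lemma kf2N a b c d : T b (- a) c d = - T b a c d.
Proof. by rewrite -scaleN1r kf2Z mulN1r. Qed.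
Lemma kf20 b c d : T b 0 c d = 0.
Proof. by rewrite (kf_12 hT) kf10 oppr0. Qed.
Lemma kf3D a a' b c d : T b c (a + a') d = T b c a d + T b c a' d.
Proof. by rewrite (kf_23 hT) kf2D !(kf_23 hT b c) opprD. Qed.
Lemma kf3Z r a b c d : T b c (r *: a) d = r * T b c a d.
Proof. by rewrite (kf_23 hT) kf2Z (kf_23 hT b c) mulrN. Qed.
Lemma kf3N a b c d : T b c (- a) d = - T b c a d.
Proof. by rewrite -scaleN1r kf3Z mulN1r. Qed.
Lemma kf30 b c d : T b c 0 d = 0.
Proof. by rewrite (kf_23 hT) kf20 oppr0. Qed.
Lemma kf4D a a' b c d : T b c d (a + a') = T b c d a + T b c d a'.
Proof. by rewrite (kf_34 hT) kf3D !(kf_34 hT b c d) opprD. Qed.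
Lemma kf4Z r a b c d : T b c d (r *: a) = r * T b c d a.
Proof. by rewrite (kf_34 hT) kf3Z (kf_34 hT b c d) mulrN. Qed.
Lemma kf4N a b c d : T b c d (- a) = - T b c d a.
Proof. by rewrite -scaleN1r kf4Z mulN1r. Qed.
Lemma kf40 b c d : T b c d 0 = 0.
Proof. by rewrite (kf_34 hT) kf30 oppr0. Qed.
Definition kfE := (kf1D, kf2D, kf3D, kf4D, kf1Z, kf2Z, kf3Z, kf4Z, kf1N, kf2N, kf3N, kf4N,
  kf10, kf20, kf30, kf40).

Lemma kf_alt12 a c d : T a a c d = 0.
Proof. by have := kf_12 hT a a c d; lra. Qed.
Lemma kf_alt23 a c d : T c a a d = 0.
Proof. by have := kf_23 hT c a a d; lra. Qed.
Lemma kf_alt34 a c d : T c d a a = 0.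
Proof. by have := kf_34 hT c d a a; lra. Qed.
Lemma kf_alt13 a c d : T a c a d = 0.
Proof. by rewrite (kf_12 hT) kf_alt23 oppr0. Qed.
Lemma kf_alt24 a c d : T c a d a = 0.
Proof. by rewrite (kf_23 hT) kf_alt34 oppr0. Qed.
Lemma kf_alt14 a c d : T a c d a = 0.
Proof. by rewrite (kf_12 hT) kf_alt24 oppr0. Qed.
Definition kf_altE := (kf_alt12, kf_alt13, kf_alt14, kf_alt23, kf_alt24, kf_alt34).

Lemma kf_rot a b c d : T a b c d = T b c a d.
Proof. by rewrite (kf_12 hT) (kf_23 hT) opprK. Qed.

Section Base.
Variable x : g.
Hypothesis x0 : x != 0.
Local Notation F := (T x (J x)).

Lemma slice_anti y v : F y v = - F v y.
Proof. exact: (kf_34 hT). Qed.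

Lemma slice_JJ y v : F (J y) (J v) = F y v.
Proof. by rewrite (kf_J hT) JJ kfE opprK. Qed.

Lemma slice_line y v : y \in Jline x -> F y v = 0.
Proof.
by move=> /mem_Jline[a [b ->]]; rewrite !(kfE, kf_altE) !mulr0 addr0.
Qed.

Lemma slice_liner y v : y \in Jline x -> F v y = 0.
Proof. by move=> h; rewrite slice_anti slice_line ?oppr0. Qed.

Lemma slice_neq0 y : y \notin Jline x -> F y (J y) != 0.
Proof. exact: (kf_neq0 hT). Qed.

(** Gram-Schmidt over the complex numbers: F e (J e) is nonzero, so a complex
    multiple of e can be subtracted. *)
Lemma slice_project e v : e \notin Jline x ->
  exists a b, F e (v + (a *: e + b *: J e)) = 0 /\
              F e (J (v + (a *: e + b *: J e))) = 0.
Proof.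
move=> /slice_neq0 f0; exists (- (F e (J v) / F e (J e))), (- (F e v / F e (J e))).
by rewrite !(linearD, linearZ) /= JJ !(kfE, kf_altE); split; field.
Qed.

End Base.
End KForm.

(** * Central complex lines *)

Section CentralComplexLine.
Variables (R : realType) (g : vectType R) (br : g -> g -> g) (J : 'End(g)).
Hypothesis hbr : lie_bracket br.
Hypothesis hnil : lie_nilpotent br.
Hypothesis hJ : complex_structure br J.
Hypothesis hdim : \dim {:g} = 8%N.
Variable T : g -> g -> g -> g -> R.
Hypothesis hT : kahler_form br J T.
Variable C : g.
Hypothesis C0 : C != 0.
Hypothesis brC0 : forall x, br x C = 0.
Hypothesis brJC0 : forall x, br x (J C) = 0.

Let JJ : almost_complex J := hJ.1.
Local Notation Jline := (Jline J).
Local Notation Jstable := (Jstable J).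
Local Notation F := (T C (J C)).
Local Notation I := (Jline C).

Let brCl x : br C x = 0. Proof. by rewrite (brC hbr) brC0 oppr0. Qed.
Let brJCl x : br (J C) x = 0. Proof. by rewrite (brC hbr) brJC0 oppr0. Qed.
Let cI x i : i \in I -> br x i = 0.
Proof. by move=> /mem_Jline[a [b ->]]; rewrite !(brE hbr) brC0 brJC0 !scaler0 addr0. Qed.
Let sI : Jstable I. Proof. exact: Jstable_line. Qed.

(** Contracting dT = 0 with the central vectors C and J C leaves dF = 0. *)
Lemma slice_closed x y v : F (br x y) v - F (br x v) y + F (br y v) x = 0.
Proof.
have := kf_closed hT C (J C) x y v.
rewrite !brCl !brJCl !(kfE hT) !(kf_rot hT _ C (J C)).
lra.
Qed.

Lemma br_span_ind (P : g -> Prop) (U : {vspace g}) :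
  P 0 -> (forall x y, P x -> P y -> P (x + y)) -> (forall a x, P x -> P (a *: x)) ->
  (forall x y, P (br x y)) -> forall z, z \in br_span br U -> P z.
Proof.
move=> P0 PD PZ Pb z zU.
pose X := in_tuple [seq br x y | x <- vbasis {:g}, y <- vbasis U].
rewrite (coord_span (zU : z \in <<X>>%VS)); elim/big_ind: _ => // i _.
have /allpairsP[[x y] /= [_ _ ->]] : X`_i \in X by apply: mem_nth.
exact/PZ/Pb.
Qed.

(** Suppose not, and choose X in [g, g], not in I but central modulo I. Put D
    = ad (J X). If D = 0 modulo I, closedness gives F [y, v] (J X) = 0 for all
    y and v, hence F X (J X) = 0. Otherwise D has complex rank 1 modulo I; let
    E = D W span its image. Closedness on (J X, W, J E) and on (J X, J W, E)
    gives 2 F E (J E) = - F ([W, J E] - [J W, E]) (J X), and the bracketed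
    difference is D [W, J W], which is in I because [g, g] is in the kernel of
    D modulo I. *)
Lemma quotient_abelian x y : br x y \in I.
Proof.
suff /subvP h : (br_span br {:g} <= I)%VS by apply/h/mem_br_span; rewrite ?memvf.
apply/negPn/negP => hn.
have [|X [SX XI brX']] := engel hbr hnil (M := fun _ => True) _ hn.
  by move=> m z _ _; rewrite mem_br_span ?memvf.
have brX z : br z X \in I by apply: brX'.
have [limD|limD] := boolP (limg (adv br (J X)) <= I)%VS.
  have brJX z : br (J X) z \in I.
    by apply: (subvP limD); rewrite -(advE hbr) memv_img ?memvf.
  have : F X (J X) = 0.
    apply: (br_span_ind (P := fun z => F z (J X) = 0)) SX.
    - by rewrite (kfE hT).
    - by move=> u v hu hv; rewrite (kfE hT) hu hv addr0.
    - by move=> a u hu; rewrite (kfE hT) hu mulr0.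
    move=> u v; have := slice_closed u v (J X).
    rewrite (brC hbr u (J X)) (brC hbr v (J X)) !(kfE hT).
    by rewrite !(slice_line hT _ (brJX _)); lra.
  by apply/eqP; apply: (slice_neq0 hT).
have dI : \dim I = 2%N by apply: dim_Jline.
have [W [E [hE EI DE _]]] := adIm_kernel hbr hnil hJ sI cI XI brX limD.
have dIm := dim_adIm hbr hnil hJ sI cI XI brX limD.
have sIm := adIm_stable hbr hJ sI brX.
have EIm : E \in adIm br J I X by rewrite hE adIm_br.
have ImE : adIm br J I X = (I + Jline E)%VS.
  apply: (sub_addJline_dim JJ) => //; first exact: addvSr.
  have := addJline_subset JJ sI sIm (addvSr _ _) EIm EI.
  by rewrite hdim in dIm; lia.
have EK : E \in adKer br J I X by rewrite (adKerE J hbr).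
have JEK := adKer_stable hbr hJ sI brX EK; rewrite (adKerE J hbr) in JEK.
have hJW := ad_J hbr hJ sI brX W; rewrite -hE in hJW.
have h1 := slice_closed (J X) W (J E).
have h2 := slice_closed (J X) (J W) E.
have h3 : br W (J W) \in adKer br J I X.
  exact: (br_adKer hbr hnil hJ sI cI XI brX hE EI ImE).
rewrite (adKerE J hbr) in h3.
have eJW : br (J X) (J W) = (br (J X) (J W) - J E) + J E by rewrite subrK.
have h4 : F (br W (J E) - br (J W) E) (J X) = 0.
  apply: (slice_line hT); move: h3; rewrite (br_der hbr) -hE eJW (brDr hbr).
  by rewrite (cI _ hJW) add0r (brC hbr E) addrC.
rewrite -hE in h1; rewrite eJW in h2.
have e1 : F (br (J X) (J E)) W = 0 by apply: (slice_line hT).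
have e2 : F (br (J X) E) (J W) = 0 by apply: (slice_line hT).
have e3 : F (br (J X) (J W) - J E) E = 0 by apply: (slice_line hT).
have := slice_neq0 hT C0 EI; rewrite (slice_anti hT) oppr_eq0 => /eqP; apply.
move: h2 h4 h1 e3; rewrite !(kfE hT) e1 e2 (slice_anti hT C (J E) E).
lra.
Qed.


Definition Forth y v := F y v = 0 /\ F y (J v) = 0.

Lemma Forth_J y v : Forth y v ->
  [/\ F y v = 0, F y (J v) = 0, F (J y) v = 0 & F (J y) (J v) = 0].
Proof.
move=> [h1 h2]; split=> //.
- by rewrite (kf_J hT) h2 oppr0.
by rewrite (slice_JJ JJ hT).
Qed.

Lemma kf_br_line x y v w : F v w = 0 -> T (br x y) (J C) v w = 0 /\ T (br x y) C v w = 0.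
Proof.
move=> h; have /mem_Jline[a [b ->]] := quotient_abelian x y.
by rewrite !(kfE hT, kf_altE hT) (kf_12 hT (J C)) h oppr0 !mulr0 addr0.
Qed.

(** If a, b and c, d are the coordinates of [x, y] and [v, w] on C and J C,
    the contractions of dT = 0 with J C and C are lam /\ F = 0 for the two
    coordinates lam of the bracket; F-orthogonality of the planes removes the
    mixed terms. *)
Lemma orth_planes_closed x y v w a b c d :
    br x y = a *: C + b *: J C -> br v w = c *: C + d *: J C ->
    F x v = 0 -> F x w = 0 -> F y v = 0 -> F y w = 0 ->
  a * F v w + c * F x y = 0 /\ b * F v w + d * F x y = 0.
Proof.
move=> e1 e2 xv xw yv yw.
have := kf_closed hT (J C) x y v w; have := kf_closed hT C x y v w.
rewrite !brCl !brJCl !(kfE hT).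
have [-> ->] := kf_br_line x v yw; have [-> ->] := kf_br_line x w yv.
have [-> ->] := kf_br_line y v xw; have [-> ->] := kf_br_line y w xv.
rewrite e1 e2 !(kfE hT, kf_altE hT) !(kf_12 hT (J C) C).
by split; lra.
Qed.

(** Each coordinate lam of the bracket gives numbers l_k = lam e_k (J e_k) and
    f_k = F e_k (J e_k) with l_i f_j + l_j f_i = 0 for i <> j. For three
    indices and nonzero f_k this forces l_k = 0. *)
Lemma orth3_line e1 e2 e3 : e1 \notin I -> e2 \notin I -> e3 \notin I ->
  Forth e1 e2 -> Forth e1 e3 -> Forth e2 e3 -> br e1 (J e1) = 0.
Proof.
move=> /(slice_neq0 hT C0) n1 /(slice_neq0 hT C0) n2 /(slice_neq0 hT C0) n3.
move=> /Forth_J[p1 p2 p3 p4] /Forth_J[q1 q2 q3 q4] /Forth_J[r1 r2 r3 r4].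
have /mem_Jline[a1 [b1 h1]] := quotient_abelian e1 (J e1).
have /mem_Jline[a2 [b2 h2]] := quotient_abelian e2 (J e2).
have /mem_Jline[a3 [b3 h3]] := quotient_abelian e3 (J e3).
have [A12 B12] := orth_planes_closed h1 h2 p1 p2 p3 p4.
have [A13 B13] := orth_planes_closed h1 h3 q1 q2 q3 q4.
have [A23 B23] := orth_planes_closed h2 h3 r1 r2 r3 r4.
have key (x y z u v w : R) : u != 0 -> v != 0 -> w != 0 ->
    x * v + y * u = 0 -> x * w + z * u = 0 -> y * w + z * v = 0 -> x = 0.
  move=> u0 v0 w0 hA hB hC.
  have : 2 * x * (v * w) = w * (x * v + y * u) + v * (x * w + z * u) - u * (y * w + z * v).
    by ring.
  rewrite hA hB hC !mulr0 addr0 subr0 => /eqP.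
  by rewrite !mulf_eq0 (negPf v0) (negPf w0) pnatr_eq0 /= !orbF => /eqP.
by rewrite h1 (key _ _ _ _ _ _ n1 n2 n3 A12 A13 A23)
   (key _ _ _ _ _ _ n1 n2 n3 B12 B13 B23) !scale0r addr0.
Qed.

Lemma orth3_cross x y e : e \notin I -> F x y = 0 ->
  F x e = 0 -> F x (J e) = 0 -> F y e = 0 -> F y (J e) = 0 -> br x y = 0.
Proof.
move=> /(slice_neq0 hT C0) n3 xy xe xJe ye yJe.
have /mem_Jline[a1 [b1 h1]] := quotient_abelian x y.
have /mem_Jline[a3 [b3 h3]] := quotient_abelian e (J e).
have := orth_planes_closed h1 h3 xe xJe ye yJe.
rewrite xy !mulr0 !addr0 => -[/eqP hA /eqP hB].
move: hA hB; rewrite !mulf_eq0 (negPf n3) !orbF => /eqP a0 /eqP b0.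
by rewrite h1 a0 b0 !scale0r addr0.
Qed.

Lemma Forth_orth_sym y v : Forth y v -> Forth v y.
Proof.
move=> /Forth_J[h1 h2 h3 h4]; split; rewrite (slice_anti hT) ?h1 ?h3 oppr0 //.
Qed.

Lemma orth_frame : exists e1 e2 e3,
  [/\ e1 \notin I, e2 \notin I & e3 \notin I] /\
  [/\ Forth e1 e2, Forth e1 e3, Forth e2 e3 &
      (I + Jline e1 + Jline e2 + Jline e3)%VS = {:g}%VS].
Proof.
have sl x : Jstable (Jline x) by apply: Jstable_line.
have pick (U : {vspace g}) : (\dim U < 8)%N -> exists x, x \notin U.
  move=> h; have /subvPn[x _ hx] : ~~ ({:g} <= U)%VS.
    by apply/negP => /dimvS; rewrite hdim leqNgt h.
  by exists x.
have [|e1 n1] := pick I; first by rewrite (dim_Jline JJ C0).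
have d1 := dim_addJline JJ sI n1; rewrite (dim_Jline JJ C0) in d1.
have s1 := Jstable_add sI (sl e1).
have [|e2 n2] := pick (I + Jline e1)%VS; first by rewrite d1.
have [a [b [o1 o2]]] := slice_project JJ hT C0 e2 n1.
set e2' := e2 + _ in o1 o2.
have m2 : e2' - e2 \in (I + Jline e1)%VS.
  by rewrite mem_addvr // /e2' [_ - e2]addrC addKr; apply/mem_Jline; exists a, b.
have n2' : e2' \notin (I + Jline e1)%VS.
  by apply: contra n2 => h; rewrite -(subKr e2' e2) memvB.
have d2 := dim_addJline JJ s1 n2'; rewrite d1 in d2.
have s2 := Jstable_add s1 (sl e2').
have [|e3 n3] := pick (I + Jline e1 + Jline e2')%VS; first by rewrite d2.
have [a3 [b3 [p1 p2]]] := slice_project JJ hT C0 e3 n1.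
have n2I : e2' \notin I by apply: contra n2' => h; apply: mem_addvl.
set e3' := e3 + _ in p1 p2.
have [a4 [b4 [q1 q2]]] := slice_project JJ hT C0 e3' n2I.
set e3'' := e3' + _ in q1 q2.
have m3 : e3'' - e3 \in (I + Jline e1 + Jline e2')%VS.
  have -> : e3'' - e3 = (a3 *: e1 + b3 *: J e1) + (a4 *: e2' + b4 *: J e2').
    by rewrite /e3'' /e3' -[e3 + _ + _]addrA [_ - e3]addrC addKr.
  rewrite memvD //.
    by rewrite mem_addvl // mem_addvr //; apply/mem_Jline; exists a3, b3.
  by rewrite mem_addvr //; apply/mem_Jline; exists a4, b4.
have n3' : e3'' \notin (I + Jline e1 + Jline e2')%VS.
  by apply: contra n3 => h; rewrite -(subKr e3'' e3) memvB.
have d3 := dim_addJline JJ s2 n3'; rewrite d2 in d3.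
exists e1, e2', e3''; split; split=> //.
- by apply: contra n3' => h; do 2 apply: mem_addvl.
- split; rewrite /e3''.
    by rewrite (kf4D hT) p1 (kf4D hT) !(kf4Z hT) o1 o2 !mulr0 !addr0.
  rewrite linearD (kf4D hT) p2 linearD !linearZ /= JJ (kf4D hT) !(kf4Z hT) (kf4N hT).
  by rewrite o1 o2 oppr0 !mulr0 !addr0.

- by apply/eqP; rewrite eqEdim subvf d3 hdim.
Qed.

(** The product with F is injective on 2-forms in real dimension 6: on an
    F-orthogonal frame this is [orth3_line] for the diagonal entries, and for
    an entry across two lines it follows by pairing with the third line. *)
Lemma central_line_abelian : lie_abelian br.
Proof.
have [e1 [e2 [e3 [[n1 n2 n3] [o12 o13 o23 full]]]]] := orth_frame.
have o21 := Forth_orth_sym o12; have o31 := Forth_orth_sym o13.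
have o32 := Forth_orth_sym o23.
have l1 := orth3_line n1 n2 n3 o12 o13 o23.
have l2 := orth3_line n2 n1 n3 o21 o23 o13.
have l3 := orth3_line n3 n1 n2 o31 o32 o12.
have cross x y e : e \notin I -> Forth x y -> Forth x e -> Forth y e ->
   [/\ br x y = 0, br x (J y) = 0, br (J x) y = 0 & br (J x) (J y) = 0].
  move=> ne /Forth_J[p1 p2 p3 p4] /Forth_J[q1 q2 q3 q4] /Forth_J[r1 r2 r3 r4].
  by split; apply: (orth3_cross ne).
have [a1 a2 a3 a4] := cross _ _ _ n3 o12 o13 o23.
have [b1 b2 b3 b4] := cross _ _ _ n2 o13 o12 o32.
have [c1 c2 c3 c4] := cross _ _ _ n1 o23 o21 o31.
move=> x y.
have span v : exists i (c : 'I_6 -> R), i \in I /\ v = i + (c 0 *: e1 + c 1 *: J e1) +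
   (c 2 *: e2 + c 3 *: J e2) + (c 4 *: e3 + c 5 *: J e3).
  have : v \in (I + Jline e1 + Jline e2 + Jline e3)%VS by rewrite full memvf.
  move=> /memv_addJline[p [s [t [/memv_addJline[q [s' [t' [
     /memv_addJline[i [s'' [t'' [Ii ->]]]] ->]]]] ->]]]].
  exists i, (fun k => nth 0 [:: s''; t''; s'; t'; s; t] k); split=> //.
have [i [c [Ii ->]]] := span x; have [j [d [Ij ->]]] := span y.
have nul u v : br u v = 0 -> br v u = 0 by move=> h; rewrite (brC hbr) h oppr0.
have il z : br i z = 0 by apply: nul; apply: cI.
have bb z : br z z = 0 by apply: brxx.
rewrite !(brE hbr) !(cI _ Ij) !il !bb l1 l2 l3 (nul _ _ l1) (nul _ _ l2) (nul _ _ l3).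
rewrite a1 a2 a3 a4 b1 b2 b3 b4 c1 c2 c3 c4.
rewrite (nul _ _ a1) (nul _ _ a2) (nul _ _ a3) (nul _ _ a4).
rewrite (nul _ _ b1) (nul _ _ b2) (nul _ _ b3) (nul _ _ b4).
rewrite (nul _ _ c1) (nul _ _ c2) (nul _ _ c3) (nul _ _ c4).
by rewrite !(scaler0, addr0).
Qed.

End CentralComplexLine.

(** * Central vectors without a central complex line *)

Section NoCentralLine.
Variables (R : realType) (g : vectType R) (br : g -> g -> g) (J : 'End(g)).
Hypothesis hbr : lie_bracket br.
Hypothesis hnil : lie_nilpotent br.
Hypothesis hJ : complex_structure br J.
Hypothesis hdim : \dim {:g} = 8%N.
Variable T : g -> g -> g -> g -> R.
Hypothesis hT : kahler_form br J T.
Hypothesis no_central_line : forall x : g, x != 0 ->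
  (forall y, br y x = 0) -> (forall y, br y (J x) = 0) -> False.
Variable C : g.
Hypothesis C0 : C != 0.
Hypothesis brC0 : forall x, br x C = 0.

Let JJ : almost_complex J := hJ.1.
Local Notation Jline := (Jline J).
Local Notation Jstable := (Jstable J).
Local Notation D := (br (J C)).
Local Notation Im := (adIm br J 0%VS C).
Local Notation Ker := (adKer br J 0%VS C).

Let brCl x : br C x = 0. Proof. by rewrite (brC hbr) brC0 oppr0. Qed.
Let s0 : Jstable 0%VS. Proof. exact: Jstable0. Qed.
Let c0 x i : i \in 0%VS -> br x i = 0.
Proof. by rewrite memv0 => /eqP ->; rewrite (br0r hbr). Qed.
Let Cn0 : C \notin 0%VS. Proof. by rewrite memv0. Qed.
Let brX x : br x C \in 0%VS. Proof. by rewrite brC0 mem0v. Qed.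
Let sl x : Jstable (Jline x). Proof. exact: Jstable_line. Qed.
Let sIm : Jstable Im. Proof. exact: (adIm_stable hbr hJ s0 brX). Qed.
Let sKer : Jstable Ker. Proof. exact: (adKer_stable hbr hJ s0 brX). Qed.
Let Im_ad y : D y \in Im. Proof. exact: adIm_br. Qed.

Lemma KerP y : reflect (D y = 0) (y \in Ker).
Proof. by rewrite (adKerE J hbr) memv0; apply: eqP. Qed.

Lemma ImP y : y \in Im -> exists w, y = D w.
Proof.
rewrite /adIm addv0 => /memv_imgP[w _ ->]; exists w; exact: (advE hbr).
Qed.

Lemma DJ y : D (J y) = J (D y).
Proof. by apply/eqP; rewrite -subr_eq0 -memv0 (ad_J hbr hJ s0 brX). Qed.

Lemma C_Im : C \notin Im.
Proof. exact: (X_adIm hbr hnil hJ s0 c0 Cn0 brX). Qed.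

(** By [Jline_normalizer] such an ideal would be a central complex line. *)
Lemma no_line_ideal E : E != 0 ->
  (forall x, br x E \in Jline E) -> (forall x, br x (J E) \in Jline E) -> False.
Proof.
move=> E0 h1 h2.
have h : forall m y, True -> y \in (0 + Jline E)%VS -> br m y \in 0%VS.
  apply: (Jline_normalizer hbr hnil hJ (M := fun=> True)) => //.
  - by move=> m y _ /c0 ->; rewrite mem0v.
  - by move=> m _; rewrite add0v.
  - by move=> m _; rewrite add0v.
apply: (no_central_line E0) => y; apply/eqP; rewrite -memv0; apply: h => //; rewrite add0v.
  exact: Jline_id.
exact: Jline_J.
Qed.

Lemma Jline0 x a b : x != 0 -> a *: x + b *: J x = 0 -> a = 0 /\ b = 0.
Proof.
move=> x0 e; apply: (Jstable_unit JJ s0 (x := x)); rewrite ?memv0 //.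
by rewrite e.
Qed.

(** D acts on W, K, E as a Jordan block of length 3. The kernel of D, and then
    K and J K, normalize the complex line of E, hence centralize it. So dT = 0
    on (J C, K, J K, E, J E) and on (C, K, J K, E, J E) involves [K, J K]
    only, and puts it in the complex line of E. Applying D to [W, K], [W, J K]
    and to their analogues for J W then shows that all of g normalizes this
    line. *)
Lemma adIm_rank2_false W E K : K = D W -> E = D K -> E != 0 -> D E = 0 ->
  \dim Im = 4%N -> False.
Proof.
move=> hK hE E0 DE dIm.
have dKer : \dim Ker = 4%N.
  have := dim_adKer_adIm br J Cn0; rewrite dimv0 hdim dIm; lia.
have KE : K \notin Jline E.
  apply/negP => /mem_Jline[a [b e]]; move: E0; rewrite hE e !(brE hbr) DJ DE.
  by rewrite !(linear0, scaler0) addr0 eqxx.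
have dE := dim_Jline JJ E0.
have ImE : Im = (Jline E + Jline K)%VS.
  apply: (sub_addJline_dim JJ) => //.
  - by apply: Jstable_sub => //; rewrite hE.
  - by rewrite hK.
  - by rewrite dIm dE.
have EC : E \notin Jline C.
  apply/negP => /mem_Jline[a [b e]].
  have : a *: C + b *: J C \in Im by rewrite -e hE.
  move=> /(Jstable_unit JJ sIm)/(_ C_Im)[a0 b0]; move: E0.
  by rewrite e a0 b0 !scale0r addr0 eqxx.
have KerE : Ker = (Jline C + Jline E)%VS.
  apply: (sub_addJline_dim JJ) => //.
  - by apply: Jstable_sub => //; apply/KerP; apply: brC0.
  - exact/KerP.
  - by rewrite dKer dim_Jline.
have cap v : v \in Im -> D v = 0 -> v \in Jline E.
  rewrite ImE => /memv_addJline[e [a [b [he ->]]]].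
  have De : D e = 0.
    case/mem_Jline: he => p [q ->].
    by rewrite !(brE hbr) DJ DE !(linear0, scaler0) addr0.
  rewrite !(brE hbr) DJ De add0r -hE => /(Jline0 E0)[-> ->].
  by rewrite !scale0r !addr0.
have DJE : D (J E) = 0 by rewrite DJ DE linear0.
have kerE y : y \in Ker -> br y E = 0 /\ br y (J E) = 0.
  move=> hy; have h : forall m z, m \in Ker -> z \in (0 + Jline E)%VS -> br m z \in 0%VS.
    apply: (Jline_normalizer hbr hnil hJ (M := fun m => m \in Ker)) => //.
    - by move=> m z _ /c0 ->; rewrite mem0v.
    - move=> m /KerP Dm; rewrite add0v; apply: cap.
        by have := br_der hbr (J C) m K; rewrite Dm -hE (br0l hbr) add0r => <-.
      by rewrite (br_der hbr) Dm DE (br0l hbr) (br0r hbr) addr0.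
    - move=> m /KerP Dm; rewrite add0v; apply: cap.
        by have := br_der hbr (J C) m (J K); rewrite Dm DJ -hE (br0l hbr) add0r => <-.
      by rewrite (br_der hbr) Dm DJE (br0l hbr) (br0r hbr) addr0.
  by split; apply/eqP; rewrite -memv0; apply: h => //; rewrite add0v;
     rewrite ?Jline_id ?Jline_J.
have EKer : E \in Ker by apply/KerP.
have JEKer : J E \in Ker by apply: sKer.
have [EJE JEE] : br E (J E) = 0 /\ br (J E) E = 0.
  by split; [apply: (kerE E EKer).2 | apply: (kerE _ JEKer).1].
have KEs : [/\ br K E = 0, br K (J E) = 0, br (J K) E = 0 & br (J K) (J E) = 0].
  have one e w k : D w = k -> D k \in Ker -> D e = 0 -> (e = E \/ e = J E) ->
      br k e \in Jline E.
    move=> Dw Dk De he; apply: cap.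
      by have := br_der hbr (J C) w e; rewrite De Dw (br0r hbr) addr0 => <-.
    rewrite (br_der hbr) De (br0r hbr) addr0.
    by case: he => ->; [apply: (kerE _ Dk).1 | apply: (kerE _ Dk).2].
  have h1 : br K E \in Jline E by apply: (one E W) => //; rewrite -?hE; auto.
  have h2 : br K (J E) \in Jline E by apply: (one (J E) W) => //; rewrite -?hE; auto.
  have DJK : D (J K) = J E by rewrite DJ -hE.
  have DJW : D (J W) = J K by rewrite DJ -hK.
  have h3 : br (J K) E \in Jline E by apply: (one E (J W)) => //; rewrite ?DJK; auto.
  have h4 : br (J K) (J E) \in Jline E by apply: (one (J E) (J W)) => //; rewrite ?DJK; auto.
  have h : forall m z, m \in Jline K -> z \in (0 + Jline E)%VS -> br m z \in 0%VS.
    apply: (Jline_normalizer hbr hnil hJ (M := fun m => m \in Jline K)) => //.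
    - by move=> m; apply: sl.
    - by move=> m z _ /c0 ->; rewrite mem0v.
    - by move=> m /mem_Jline[a [b ->]]; rewrite add0v !(brE hbr) memvD // memvZ.
    - by move=> m /mem_Jline[a [b ->]]; rewrite add0v !(brE hbr) memvD // memvZ.
  by split; apply/eqP; rewrite -memv0; apply: h; rewrite ?add0v ?Jline_id ?Jline_J.
case: KEs => KE1 KE2 KE3 KE4.
set P := br K (J K).
have DP : D P = 0.
  by rewrite (br_der hbr) DJ -hE (brC hbr E) KE3 KE2 oppr0 addr0.
have PE : P \in Jline E.
  have : P \in Ker by apply/KerP.
  rewrite KerE => /memv_addJline[p [a [b [/mem_Jline[c [d ->]] eP]]]].
  have t1 := kf_closed hT (J C) K (J K) E (J E).
  have t2 := kf_closed hT C K (J K) E (J E).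
  move: t1 t2; rewrite -/P DJ DE DJE KE1 KE2 KE3 KE4 EJE -hE !brCl eP.
  rewrite !(kfE hT, kf_altE hT) (kf_12 hT (J C)) => t1 t2.
  have n := kf_neq0 hT C0 EC.
  have c00 : c = 0.
    apply/eqP; have : c * T C (J C) E (J E) = 0 by lra.
    by move/eqP; rewrite mulf_eq0 (negPf n) orbF.
  have d00 : d = 0.
    apply/eqP; have : d * T C (J C) E (J E) = 0 by lra.
    by move/eqP; rewrite mulf_eq0 (negPf n) orbF.
  rewrite c00 d00 !scale0r addr0 add0r; apply/mem_Jline; by exists a, b.
have EIm : (Jline E <= Im)%VS by apply: Jstable_sub => //; rewrite hE.
have PIm : P \in Im by apply: (subvP EIm).
have DJK : D (J K) = J E by rewrite DJ -hE.
have DJW : D (J W) = J K by rewrite DJ -hK.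
have w1 : br W E \in Jline E.
  apply: cap; last by rewrite (br_der hbr) -hK KE1 DE (br0r hbr) addr0.
  by have := br_der hbr (J C) W K; rewrite -hK -hE (brxx hbr) add0r => <-.
have w2 : br W (J E) \in Jline E.
  apply: cap; last by rewrite (br_der hbr) -hK KE2 DJE (br0r hbr) addr0.
  have e := br_der hbr (J C) W (J K); rewrite DJK -hK -/P in e.
  by rewrite -(addKr P (br W (J E))) -e memvD ?memvN.
have w3 : br (J W) E \in Jline E.
  apply: cap; last by rewrite (br_der hbr) DJW KE3 DE (br0r hbr) addr0.
  have e := br_der hbr (J C) (J W) K.
  rewrite DJW -hE (brC hbr (J K)) -/P in e.
  by rewrite -(addKr (- P) (br (J W) E)) -e opprK memvD.
have w4 : br (J W) (J E) \in Jline E.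
  apply: cap; last by rewrite (br_der hbr) DJW KE4 DJE (br0r hbr) addr0.
  have := br_der hbr (J C) (J W) (J K).
  by rewrite DJW DJK (brxx hbr) add0r => <-.
have KKer : K \notin Ker by apply/negP => /KerP; rewrite -hE => /eqP; apply/negP.
have sU := Jstable_add sKer (@sl K).
have WU : W \notin (Ker + Jline K)%VS.
  apply/negP => /memv_addJline[p [a [b [/KerP hp e]]]].
  case/negP: KE; apply/mem_Jline; exists a, b.
  by rewrite hK e !(brE hbr) hp DJK add0r -hE.
have full : (Ker + Jline K + Jline W)%VS = {:g}%VS.
  apply/eqP; rewrite eqEdim subvf (dim_addJline JJ) // (dim_addJline JJ) //.
  by rewrite dKer hdim.
have all x : br x E \in Jline E /\ br x (J E) \in Jline E.
  have : x \in (Ker + Jline K + Jline W)%VS by rewrite full memvf.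
  case/memv_addJline=> p [a [b [/memv_addJline[q [c [d [hq ->]]]] ->]]].
  have [q1 q2] := kerE _ hq.
  rewrite !(brE hbr) q1 q2 KE1 KE2 KE3 KE4 !scaler0 !add0r.
  by split; rewrite memvD // memvZ.
by apply: (no_line_ideal E0) => x; case: (all x).
Qed.

(** The image has complex dimension 1 or 2, and dimension 2 is excluded. *)
Lemma adIm_line : exists W E,
  [/\ E = D W, E != 0, D E = 0 & Im = (0 + Jline E)%VS].
Proof.
have limD : ~~ (limg (adv br (J C)) <= 0)%VS.
  apply/negP => h; apply: (no_central_line C0 brC0) => y; rewrite (brC hbr).
  have : D y \in 0%VS by apply: (subvP h); rewrite -(advE hbr) memv_img ?memvf.
  by rewrite memv0 => /eqP ->; rewrite oppr0.
have dIm := dim_adIm hbr hnil hJ s0 c0 Cn0 brX limD; rewrite hdim in dIm.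
have [W [E [hE EI DE _]]] := adIm_kernel hbr hnil hJ s0 c0 Cn0 brX limD.
move: EI DE; rewrite !memv0 => E0 /eqP DE.
have [h|/subvPn[y yIm yE]] := boolP (Im <= Jline E)%VS.
  exists W, E; split=> //; rewrite add0v; apply/eqP; rewrite eqEsubv h.
  by apply: Jstable_sub => //; rewrite hE.
have EIm : (Jline E <= Im)%VS by apply: Jstable_sub => //; rewrite hE.
have d4 := addJline_subset JJ (@sl E) sIm EIm yIm yE.
rewrite (dim_Jline JJ E0) in d4.
have {d4 dIm} dIm : \dim Im = 4%N by lia.
have dKer : \dim Ker = 4%N.
  have := dim_adKer_adIm br J Cn0; rewrite dimv0 hdim dIm; lia.
pose S := (adv br (J C) @: Im)%VS.
have SD v : v \in Im -> D v \in S.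
  by move=> hv; rewrite -(advE hbr); apply: memv_img.
have S0 : ~~ (S <= 0)%VS.
  apply/negP => hS0.
  have ImKer : (Im <= Ker)%VS.
    apply/subvP => v hv; apply/KerP/eqP; rewrite -memv0.
    by apply: (subvP hS0); apply: SD.
  have CK : C \in Ker by apply/KerP.
  by have := addJline_subset JJ sIm sKer ImKer CK C_Im; rewrite dIm dKer.
have [|s [/memv_imgP[k kIm es] sn /(_ _ erefl) Ds]] :=
    engel hbr hnil (M := fun m => m = J C) _ S0.
  move=> _ x -> /memv_imgP[k kIm ->]; rewrite SD // (advE hbr) //.
move: es sn Ds; rewrite (advE hbr) !memv0 => es sn /eqP Ds.
have [w ew] := ImP kIm.
by case: (adIm_rank2_false ew es).
Qed.


Section Slice.
Variable W : g.
Local Notation E := (D W).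
Hypothesis E0 : E != 0.
Hypothesis ImE : Im = (0 + Jline E)%VS.
Local Notation h := (br W (J E)).
Local Notation F := (T C (J C)).

Let En0 : E \notin 0%VS. Proof. by rewrite memv0. Qed.
Let DJW : D (J W) = J E. Proof. exact: DJ. Qed.

Lemma Ker_line y e : y \in Ker -> e \in Jline E -> br y e = 0.
Proof.
move=> hy he; apply/eqP; rewrite -memv0.
by apply: (adKer_Jline hbr hnil hJ s0 c0 brX erefl ImE); rewrite ?add0v.
Qed.

Lemma Ker_E y : y \in Ker -> br y E = 0.
Proof. by move=> hy; rewrite Ker_line // Jline_id. Qed.
Lemma Ker_JE y : y \in Ker -> br y (J E) = 0.
Proof. by move=> hy; rewrite Ker_line // Jline_J. Qed.
Lemma E_Ker y : y \in Ker -> br E y = 0.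
Proof. by move=> hy; rewrite (brC hbr) Ker_E ?oppr0. Qed.
Lemma JE_Ker y : y \in Ker -> br (J E) y = 0.
Proof. by move=> hy; rewrite (brC hbr) Ker_JE ?oppr0. Qed.

Lemma br_Ker x y : br x y \in Ker.
Proof. exact: (br_adKer hbr hnil hJ s0 c0 Cn0 brX erefl En0 ImE). Qed.

Lemma Ker_full x : exists y a b, y \in Ker /\ x = y + (a *: W + b *: J W).
Proof.
have : x \in (Ker + Jline W)%VS.
  by rewrite (adKer_span hbr hJ s0 Cn0 brX erefl En0 ImE) memvf.
by case/memv_addJline=> y [a [b [hy ->]]]; exists y, a, b.
Qed.

Lemma dim_Ker : \dim Ker = 6%N.
Proof. by rewrite (dim_adKer1 hJ s0 Cn0 En0 ImE) hdim. Qed.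

Lemma EKer : E \in Ker.
Proof. exact: br_Ker. Qed.
Lemma DE0 : D E = 0. Proof. exact/KerP/EKer. Qed.
Lemma DJE0 : D (J E) = 0. Proof. by rewrite DJ DE0 linear0. Qed.

Lemma CKer : C \in Ker. Proof. exact/KerP/brC0. Qed.

Lemma E_notin_line : E \notin Jline C.
Proof.
apply/negP => /mem_Jline[a [b e]].
have : a *: C + b *: J C \in Im by rewrite -e.
move=> /(Jstable_unit JJ sIm)/(_ C_Im)[a0 b0].
by case/eqP: E0; rewrite e a0 b0 !scale0r addr0.
Qed.

Local Notation P := (Jline C + Jline E)%VS.

Let sP : Jstable P. Proof. exact: Jstable_add. Qed.

Lemma dim_P : \dim P = 4%N.
Proof. by rewrite (dim_addJline JJ) ?E_notin_line // (dim_Jline JJ C0). Qed.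

Lemma P_sub_Ker : (P <= Ker)%VS.
Proof. by rewrite subv_add !Jstable_sub ?CKer ?EKer. Qed.

Lemma W_JC : br W (J C) = - E. Proof. exact: (brC hbr). Qed.
Lemma JW_JC : br (J W) (J C) = - J E. Proof. by rewrite (brC hbr) DJW. Qed.

(** D kills [W, J W], because [g, g] is in the kernel of D. *)
Lemma JW_E : br (J W) E = h.
Proof.
have /KerP := br_Ker W (J W); rewrite (br_der hbr) DJW (brC hbr E) addrC => /eqP.
by rewrite subr_eq0 => /eqP.
Qed.

Lemma JW_JE : br (J W) (J E) = br W E + 2 *: J h.
Proof.
rewrite (br_JJ hJ) JW_E.
by apply: coord_ext => k; rewrite !(linearD,linearZ,linearN) /=; ring.
Qed.

(** The next three relations are dT = 0 on (C, J C, w, e, y) with w in <W, J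
    W> and e in <E, J E>. *)
Lemma Frel1 y : y \in Ker -> F (br W E) y = F (br W y) E.
Proof.
move=> hy; have := kf_closed hT C (J C) W E y.
rewrite !brCl DE0 (KerP y hy) (E_Ker hy) !(kfE hT, kf_altE hT).
rewrite (kf_rot hT _ C (J C) y) (kf_rot hT _ C (J C) E); lra.
Qed.

Lemma Frel2 y : y \in Ker -> F (br (J W) (J E)) y = F (br (J W) y) (J E).
Proof.
move=> hy; have := kf_closed hT C (J C) (J W) (J E) y.
rewrite !brCl DJE0 (KerP y hy) (JE_Ker hy) DJW !(kfE hT, kf_altE hT).
rewrite (kf_rot hT _ C (J C) y) (kf_rot hT _ C (J C) (J E)); lra.
Qed.

(** Here (w, e) = (W, J E) and (J W, E) are added: each leaves a term T E C (J
    E) y coming from D w, and the two cancel. *)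
Lemma Frel3 y : y \in Ker ->
  2 * F h y = F (br W y) (J E) + F (br (J W) y) E.
Proof.
move=> hy; have := kf_closed hT C (J C) (J W) E y.
have := kf_closed hT C (J C) W (J E) y.
have e : T E C (J E) y = - T (J E) C E y.
  by rewrite (kf_12 hT) (kf_23 hT) (kf_12 hT) opprK.
rewrite !brCl DJE0 DE0 (KerP y hy) (JE_Ker hy) (E_Ker hy) DJW JW_E !(kfE hT, kf_altE hT) e.
rewrite (kf_rot hT _ C (J C) y) !(kf_rot hT _ C (J C) (J E)) (kf_rot hT _ C (J C) E).
lra.
Qed.

Lemma Q_JC : brQ br J W (- J C) = E.
Proof. by rewrite /brQ linearN /= JJ opprK brC0 subr0 (brNr hbr) W_JC opprK. Qed.

Lemma Q_E : brQ br J W E = - 2 *: J h.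
Proof.
rewrite /brQ JW_JE.
by apply: coord_ext => k; rewrite !(linearD,linearZ,linearN) /=; ring.
Qed.

Lemma JlineC_sub : (Jline C <= Jline (- J C))%VS.
Proof.
apply: Jstable_sub => //.
by have := Jline_J J (- J C); rewrite linearN /= JJ opprK.
Qed.

(** On the complex plane spanned by C and E, [brQ W] sends - J C to E and E to
    a multiple of J h; being nilpotent, it kills E. *)
Lemma mixed_eq0 : h \in P -> h = 0.
Proof.
move=> hP; have : brQ br J W E = 0.
  apply: (brQ_chain1 hbr hnil hJ Q_JC); rewrite Q_E.
  apply: memvZ; apply: (subvP (addvS JlineC_sub (subvv _))).
  exact: sP.
rewrite Q_E => /eqP; rewrite scaler_eq0 oppr_eq0 pnatr_eq0 /= => /eqP e.
by have := JJ h; rewrite e linear0 => /eqP; rewrite eq_sym oppr_eq0 => /eqP.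
Qed.

Lemma Ker_span_mixed : h \notin P -> Ker = (P + Jline h)%VS.
Proof.
move=> hP; apply: (sub_addJline_dim JJ) => //; first exact: P_sub_Ker.
  exact: br_Ker.
by rewrite dim_Ker dim_P.
Qed.

(** The operator [brQ W] sends - J C to E and E to - 2 J h, and these three
    vectors span Ker over the complex numbers; being nilpotent, it kills the
    last one. *)
Lemma brQ_mixed : h \notin P -> br (J W) (J h) = br W h.
Proof.
move=> hP; have e : brQ br J W (- 2 *: J h) = 0.
  apply: (brQ_chain2 hbr hnil hJ Q_JC Q_E).
  have : brQ br J W (- 2 *: J h) \in Ker by rewrite /brQ memvB ?br_Ker.
  rewrite (Ker_span_mixed hP); apply: subvP; apply: addvS; last first.
    apply: Jstable_sub => //.
    have eh : 2^-1 *: J (- 2 *: J h) = h.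
      rewrite linearZ /= JJ scalerA scalerN -scaleNr mulrN opprK mulVf ?scale1r //.
      by rewrite pnatr_eq0.
    by rewrite -[X in X \in _]eh memvZ ?Jline_J.
  by apply: addvS; rewrite ?JlineC_sub.
move: e; rewrite (brQZ J hbr) (brQ_J hbr hJ) => /eqP.
rewrite scaler_eq0 oppr_eq0 pnatr_eq0 /= => /eqP e.
have := JJ (brQ br J W h); rewrite e linear0 => /eqP.
by rewrite eq_sym oppr_eq0 /brQ subr_eq0 => /eqP ->.
Qed.


Section MixedZero.
Hypothesis h0 : h = 0.
Local Notation u := (br W E).

Let JWJE : br (J W) (J E) = u.
Proof. by rewrite JW_JE h0 linear0 scaler0 addr0. Qed.

(** The Jacobi identity, with h = 0 and [g, g] inside Ker, which centralizes E
    and J E. *)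
Lemma u_central x : br x u = 0.
Proof.
have [y [a [b [hy ->]]]] := Ker_full x.
have k1 : br y u = 0.
  by rewrite (br_der hbr) (Ker_E hy) (br0r hbr) addr0 (Ker_E (br_Ker _ _)).
have k2 : br W u = 0.
  rewrite -JWJE (br_der hbr) h0 (br0r hbr) addr0; exact: Ker_JE (br_Ker _ _).
have k3 : br (J W) u = 0.
  rewrite (br_der hbr) JW_E h0 (br0r hbr) addr0; exact: Ker_E (br_Ker _ _).
by rewrite !(brE hbr) k1 k2 k3 !scaler0 !addr0.
Qed.

Lemma u_neq0 : u != 0.
Proof.
apply/eqP => u0; apply: (no_line_ideal E0) => x; have [y [a [b [hy ->]]]] := Ker_full x.
  by rewrite !(brE hbr) Ker_E // JW_E h0 u0 !scaler0 !addr0 mem0v.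
by rewrite !(brE hbr) Ker_JE // JWJE h0 u0 !scaler0 !addr0 mem0v.
Qed.

Lemma u_Ker : u \in Ker. Proof. exact: br_Ker. Qed.

Lemma FuE : F u E = 0 /\ F u (J E) = 0.
Proof.
split.
  by rewrite -{1}JWJE Frel2 ?EKer // JW_E h0 (kfE hT).
by rewrite Frel1 ?sKer ?EKer // h0 (kfE hT).
Qed.

(** Otherwise u is independent from C and E over the complex numbers and
    together they span Ker. Let G = [J u, W]. Relation [Frel1] with y = J u
    reads F u (J u) = - F G E. Nilpotency removes the components of G on u and
    J u. As J u commutes with Ker, ad (J u) kills [W, J W], and this removes
    the component of G on J E. So F G E = 0. *)
Lemma u_line : u \in Jline C.
Proof.
apply/negPn/negP => uC.
have n := slice_neq0 hT C0 E_notin_line.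
have [fuE fuJE] := FuE.
have uP : u \notin P.
  apply/negP => /memv_addJline[p [a [b [hp e]]]].
  have p1 y : F p y = 0 by apply: (slice_line hT).
  have b0 : b = 0.
    apply/eqP; move/eqP: fuE; rewrite e (kf3D hT) p1 !(kfE hT, kf_altE hT) (slice_anti hT C (J E)).
    by rewrite mulr0 !add0r mulf_eq0 oppr_eq0 (negPf n) orbF.
  have a0 : a = 0.
    apply/eqP; move/eqP: fuJE; rewrite e (kf3D hT) p1 !(kfE hT, kf_altE hT).
    by rewrite mulr0 addr0 !add0r mulf_eq0 (negPf n) orbF.
  by case/negP: uC; rewrite e a0 b0 !scale0r !addr0.
have KerE : Ker = (P + Jline u)%VS.
  apply: (sub_addJline_dim JJ) => //; first exact: P_sub_Ker.
    exact: u_Ker.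
  by rewrite dim_Ker dim_P.
have JuK : J u \in Ker by apply/sKer/u_Ker.
have Cx := brCl; have ux x : br u x = 0 by rewrite (brC hbr) u_central oppr0.
set G := br (J u) W.
have WJu : br W (J u) = - G by rewrite (brC hbr).
have JG : br (J u) (J W) = J G.
  by rewrite (br_JJ hJ) !ux linear0 !addr0.
have JWJu : br (J W) (J u) = - J G by rewrite (brC hbr) JG.
have f : F u (J u) = - F G E by rewrite Frel1 // WJu (kfE hT).
have nu := slice_neq0 hT C0 uC.
(* S is stable under ad W and ad (J W), which have no eigenvalue on J u modulo it. *)
pose S := (P + <[u]>)%VS.
have PS x : x \in P -> x \in S by apply: mem_addvl.
have CS : C \in S by apply/PS/mem_addvl/Jline_id.
have JCS : J C \in S by apply/PS/mem_addvl/Jline_J.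
have ES : E \in S by apply/PS/mem_addvr/Jline_id.
have JES : J E \in S by apply/PS/mem_addvr/Jline_J.
have uS : u \in S by apply: mem_addvr; apply: memv_line.
have SP x : x \in S -> exists a b c d e, x = a *: C + b *: J C + (c *: E + d *: J E) + e *: u.
  move=> /memv_addP[p /memv_addJline[q [c [d [/mem_Jline[a [b ->]] ->]]]] [_ /vlineP[e ->] ->]].
  by exists a, b, c, d, e.
have WS x : x \in S -> br W x \in S.
  move=> /SP[a [b [c [d [e ->]]]]]; rewrite !(brE hbr) brC0 W_JC h0 u_central.
  by rewrite !scaler0 !addr0 !add0r memvD // memvZ // memvN.
have JWS x : x \in S -> br (J W) x \in S.
  move=> /SP[a [b [c [d [e ->]]]]]; rewrite !(brE hbr) brC0 JW_JC JW_E JWJE h0 u_central.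
  by rewrite !scaler0 !addr0 !add0r memvD // memvZ // memvN.
have JuS : J u \notin S.
  apply/negP => /memv_addP[p hp [_ /vlineP[t ->] e]].
  have : (- t) *: u + 1 *: J u \in P by rewrite scale1r e scaleNr addrCA addNr addr0.
  by move=> /(Jstable_unit JJ sP)/(_ uP)[_ /eqP]; rewrite oner_eq0.
have : G \in Ker by apply: br_Ker.
rewrite KerE => /memv_addJline[p [c [d [hp eG]]]].
have pS := PS _ hp.
have d0 : d = 0.
  apply/eqP/negPn/negP => d0; case/negP: JuS.
  apply: (nil_eigenvalue hbr hnil (m := W) (b := - d)); rewrite ?oppr_eq0 //.
  have -> : br W (J u) - - d *: J u = - (p + c *: u).
    by rewrite WJu eG; apply: coord_ext => k; rewrite !(linearD,linearZ,linearN) /=; ring.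
  by rewrite memvN memvD // memvZ.
have c0' : c = 0.
  apply/eqP/negPn/negP => cn; case/negP: JuS.
  apply: (nil_eigenvalue hbr hnil (m := J W) (b := - c)); rewrite ?oppr_eq0 //.
  have -> : br (J W) (J u) - - c *: J u = - (J p).
    rewrite JWJu eG d0 scale0r addr0 linearD linearZ /=.
    by apply: coord_ext => k; rewrite !(linearD,linearZ,linearN) /=; ring.
  by rewrite memvN PS // sP.
move: eG; rewrite d0 c0' !scale0r !addr0 => eG.
case/memv_addJline: hp => _ [a [b [/mem_Jline[q [r ->]] ep]]].
have JuKer0 y : y \in Ker -> br (J u) y = 0.
  rewrite KerE => /memv_addJline[z [s [t [hz ->]]]].
  case/memv_addJline: hz => _ [s' [t' [/mem_Jline[q' [r' ->]] ->]]].
  rewrite !(brE hbr) brC0 (brC hbr _ (J C)) (KerP _ JuK) Ker_E // Ker_JE // u_central (brxx hbr).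
  by rewrite !(scaler0, oppr0, addr0).
have e1 : br G (J W) + br W (J G) = 0.
  by have := br_der hbr (J u) W (J W); rewrite (JuKer0 _ (br_Ker _ _)) -/G JG => <-.
have e2 : (2 * b) *: u + (q *: E + (- r) *: J E) = 0.
  move: e1; rewrite (brC hbr G) eG ep !(linearD, linearZ) /= !JJ !(brE hbr).
  rewrite !brC0 W_JC JW_JC h0 JWJE JW_E h0 !(scaler0, addr0, add0r, oppr0) => e1.
  apply/eqP; rewrite -oppr_eq0 -e1; apply/eqP.
  by apply: coord_ext => k; rewrite !(linearD,linearZ,linearN) /=; ring.
have b0 : b = 0.
  apply/eqP/negPn/negP => bn; case/negP: uP.
  have -> : u = (2 * b)^-1 *: ((2 * b) *: u + (q *: E + (- r) *: J E)) -
      (2 * b)^-1 *: (q *: E + (- r) *: J E).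
    by rewrite scalerDr addrK scalerA mulVf ?scale1r // mulf_neq0 // pnatr_eq0.
  rewrite e2 scaler0 add0r memvN memvZ // mem_addvr //; apply/mem_Jline.
  by exists q, (- r).
case/eqP: nu; rewrite f eG ep b0 (kf3D hT) (slice_line hT); last by apply/mem_Jline; exists q, r.
by rewrite !(kfE hT, kf_altE hT) mulr0 mul0r !addr0 oppr0.
Qed.

Hypothesis HW : T E (J E) (J C) W = 0.

(** Now u = a C with a <> 0. Choose K in Ker outside P with [g, K] in P
    (Engel's theorem modulo P). If K, C and W are orthogonal enough, every
    term of dT = 0 on (J C, W, E, K, J K) vanishes except a F K (J K). *)
Lemma mixed_eq0_false : False.
Proof.
case/mem_Jline: (u_line) => a [b eu].
have b0 : b = 0.
  apply/eqP/negPn/negP => bn; apply: (no_central_line C0 brC0) => y.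
  have := u_central y; rewrite eu !(brE hbr) brC0 scaler0 add0r => /eqP.
  by rewrite scaler_eq0 (negPf bn) => /eqP.
move: eu; rewrite b0 scale0r addr0 => eu.
have a0 : a != 0.
  by apply/eqP => a0; have := u_neq0; rewrite eu a0 scale0r eqxx.
have CP : C \in P by apply/mem_addvl/Jline_id.
have JCP : J C \in P by apply/mem_addvl/Jline_J.
have EP : E \in P by apply/mem_addvr/Jline_id.
have JEP : J E \in P by apply/mem_addvr/Jline_J.
have gP m x : x \in P -> br m x \in P.
  move=> /memv_addJline[_ [s [t [/mem_Jline[q [r ->]] ->]]]].
  have [y [c [d [hy ->]]]] := Ker_full m.
  rewrite !(brE hbr) !brC0 (brC hbr y (J C)) (KerP _ hy) Ker_E // Ker_JE //.
  rewrite W_JC JW_JC h0 JW_E h0 JWJE eu !(scaler0, oppr0, addr0, add0r).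
  by repeat first [assumption | apply: mem0v | apply: memvD | apply: memvZ | rewrite memvN].
have nKP : ~~ (Ker <= P)%VS by apply/negP => /dimvS; rewrite dim_Ker dim_P.
have [|s [sK sP' hs]] := engel hbr hnil (M := fun=> True) _ nKP.
  by move=> m x _ _; apply: br_Ker.
have KerE : Ker = (P + Jline s)%VS.
  by apply: (sub_addJline_dim JJ) => //; rewrite ?P_sub_Ker // dim_Ker dim_P.
have KP m x : x \in Ker -> br m x \in P.
  move=> hx; apply: (Jline_normalizer hbr hnil hJ (M := fun=> True) (x := s)) => //.
  - by move=> m' y _; apply: gP.
  - by move=> m' _; rewrite -KerE br_Ker.
  - by move=> m' _; rewrite -KerE br_Ker.
  - by rewrite -KerE.
have [a1 [b1 [p1 p2]]] := slice_project JJ hT C0 s E_notin_line.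
(* K is s made orthogonal to E for F, then to C for the slice of T at E. *)
set K1 := s + _ in p1 p2.
have CE : C \notin Jline E.
  apply: contra C_Im; apply/subvP; exact: Jstable_sub.
have [a2 [b2 [q1 q2]]] := slice_project JJ hT E0 K1 CE.
set K := K1 + _ in q1 q2.
have KKer : K \in Ker.
  apply: memvD; first apply: memvD => //.
    by apply/(subvP P_sub_Ker)/mem_addvr/mem_Jline; exists a1, b1.
  by apply/(subvP P_sub_Ker)/mem_addvl/mem_Jline; exists a2, b2.
have KnP : K \notin P.
  apply: contra sP' => h; have -> : s = K - (a1 *: E + b1 *: J E) - (a2 *: C + b2 *: J C).
    by rewrite /K /K1; apply: coord_ext => k; rewrite !(linearD,linearZ,linearN) /=; ring.
  by do 2 (apply: memvB; last by rewrite memvD // memvZ).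
have KC : K \notin Jline C by apply: contra KnP; apply: mem_addvl.
have r1 : F E K = 0.
  by rewrite /K (kf4D hT) p1 (slice_liner hT) ?addr0 //; apply/mem_Jline; exists a2, b2.
have r2 : F E (J K) = 0.
  rewrite /K linearD (kf4D hT) p2 (slice_liner hT) ?addr0 //; apply: sl.
  by apply/mem_Jline; exists a2, b2.
clearbody K; clear K1 p1 p2.
have H1 : T E (J E) (J C) (J K) = 0 by rewrite (slice_JJ JJ hT).
have H2 : T E (J E) (J C) K = 0 by rewrite (kf_J hT) q2 oppr0.
have rotE v w : T (J E) v E w = T E (J E) v w by rewrite -(kf_rot hT).
have mP z : z \in P -> exists c1 c2 c3 c4, z = c1 *: C + c2 *: J C + (c3 *: E + c4 *: J E).
  move=> /memv_addJline[_ [c3 [c4 [/mem_Jline[c1 [c2 ->]] ->]]]].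
  by exists c1, c2, c3, c4.
have PJK z : z \in P -> T z (J C) E (J K) = 0.
  move=> /mP[c1 [c2 [c3 [c4 ->]]]].
  by rewrite !(kfE hT, kf_altE hT) rotE H1 r2 !(mulr0, addr0).
have PK z : z \in P -> T z (J C) E K = 0.
  move=> /mP[c1 [c2 [c3 [c4 ->]]]].
  by rewrite !(kfE hT, kf_altE hT) rotE H2 r1 !(mulr0, addr0).
have JKKer : J K \in Ker by apply: sKer.
have PW : T (br K (J K)) (J C) W E = 0.
  have := kf_closed hT (J C) K (J K) E (J E).
  rewrite (KerP _ KKer) (KerP _ JKKer) DE0 DJE0 (brC hbr E).
  rewrite !Ker_E ?Ker_JE ?sKer ?EKer //.
  have /mP[c1 [c2 [c3 [c4 ->]]]] := KP K (J K) JKKer.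
  rewrite !(kfE hT, kf_altE hT).
  have n := slice_neq0 hT C0 E_notin_line => e.
  have c10 : c1 = 0.
    apply/eqP; have : c1 * T C (J C) E (J E) = 0 by lra.
    by move/eqP; rewrite mulf_eq0 (negPf n) orbF.
  have -> : T (J E) (J C) W E = - T E (J E) (J C) W by rewrite (kf_34 hT) rotE.
  by rewrite c10 HW !(mul0r, oppr0, mulr0, addr0).
have := kf_closed hT (J C) W E K (J K).
rewrite DE0 (KerP _ KKer) (KerP _ JKKer) (E_Ker KKer) (E_Ker JKKer) eu.
rewrite (PJK _ (KP _ _ KKer)) (PK _ (KP _ _ JKKer)) PW !(kfE hT, kf_altE hT) => e.
have : a * F K (J K) = 0 by lra.
by move/eqP; rewrite mulf_eq0 (negPf a0) (negPf (slice_neq0 hT C0 KC)).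
Qed.
End MixedZero.

Section MixedNonzero.
Hypothesis hP : h \notin P.

Lemma br_line_central x y : y \in <[C]>%VS -> br x y = 0.
Proof. by move=> /vlineP[t ->]; rewrite !(brE hbr) brC0 scaler0. Qed.

(** The bracket [J W, s] is h + a [J W, h] + b [J W, J h], and [J W, J h] =
    [W, h]. Being in <C>, it makes h an eigenvector of ad (a J W + b W) modulo
    C. *)
Lemma second_center_normal_form_false s a b c :
  s = E + (a *: h + b *: J h) + c *: C ->
  (forall m, br m s \in <[C]>%VS) -> False.
Proof.
move=> es hs; have hC : h \notin <[C]>%VS.
  apply: contra hP => /vlineP[t ->]; apply/mem_addvl; rewrite memvZ //.
  exact: Jline_id.
case/negP: hC; apply: (nil_eigenvalue hbr hnil (m := - (a *: J W + b *: W)) (b := 1)).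
- by move=> x /br_line_central ->; rewrite mem0v.
- have -> : br (- (a *: J W + b *: W)) h - 1 *: h = - br (J W) s.
    rewrite es !(brE hbr) brC0 JW_E (brQ_mixed hP) scale1r.
    by apply: coord_ext => k; rewrite !(linearD,linearZ,linearN,linear0) /=; ring.
  by rewrite memvN.
- exact: oner_neq0.
Qed.

Lemma br_span_Ker_mem :
  [/\ E \in br_span br Ker, J E \in br_span br Ker,
      h \in br_span br Ker & J h \in br_span br Ker].
Proof.
have bS x y : y \in Ker -> br x y \in br_span br Ker by apply: mem_br_span.
split.
- by rewrite -[E]opprK -W_JC memvN bS // sKer // CKer.
- by rewrite -[J E]opprK -JW_JC memvN bS // sKer // CKer.
- by rewrite bS // sKer // EKer.
have -> : J h = 2^-1 *: (br (J W) (J E) - br W E).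
  by rewrite JW_JE addrC addKr scalerA mulVf ?scale1r // pnatr_eq0.
by rewrite memvZ // memvB // bS // ?sKer // EKer.
Qed.

(** Otherwise Ker = [g, Ker] + <C>, and iterating this puts Ker in <C> plus
    any term of the lower central series. *)
Lemma JC_br_span : J C \notin (br_span br Ker + <[C]>)%VS.
Proof.
apply/negP => JCS.
have [ES JES hS JhS] := br_span_Ker_mem.
have sub : (Ker <= br_span br Ker + <[C]>)%VS.
  rewrite [X in (X <= _)%VS](Ker_span_mixed hP) /Jline !subv_add -!memvE.
  by rewrite JCS (mem_addvr _ (memv_line C)) !mem_addvl.
have step k : (Ker <= lower_central br k + <[C]>)%VS.
  elim: k => [|k IH]; first exact: subv_trans (subvf _) (addvSl _ _).
  apply: subv_trans sub _; apply: addvS => //.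
  apply: br_span_sub => x y /(subvP IH)/memv_addP[l hl [z hz ->]].
  by rewrite (brDr hbr) (br_line_central _ hz) addr0; apply: mem_br_span.
case: hnil => k hk; have := step k; rewrite hk add0v => /dimvS.
by rewrite dim_Ker dim_vline; case: (_ == _).
Qed.

(** Engel's theorem in [g, Ker] + <C> gives s with [g, s] in <C>; it has no
    component on J C by [JC_br_span]. The three relations with y = s make s
    orthogonal to h and J h for F, so s is not a combination of h, J h and C.
    *)
Lemma second_center_normal_form : exists s al be a b c,
  [/\ s = (al *: E + be *: J E) + (a *: h + b *: J h) + c *: C,
      al != 0 \/ be != 0 & forall m, br m s \in <[C]>%VS].
Proof.
pose S := (br_span br Ker + <[C]>)%VS.
have bS x y : y \in Ker -> br x y \in S.
  by move=> hy; apply/mem_addvl/mem_br_span.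
have SKer : (S <= Ker)%VS.
  rewrite subv_add -memvE CKer andbT; apply: br_span_sub => x y _.
  exact: br_Ker.
have [ES0 JES0 hS0 JhS0] := br_span_Ker_mem.
have ES : E \in S by apply: mem_addvl.
have JES : J E \in S by apply: mem_addvl.
have hS : h \in S by apply: mem_addvl.
have JhS : J h \in S by apply: mem_addvl.
have CS : C \in S by apply/mem_addvr/memv_line.
have nS : ~~ (S <= <[C]>)%VS.
  apply: contra hP => /subvP/(_ _ hS)/vlineP[t ->].
  by apply/mem_addvl; rewrite memvZ // Jline_id.
have [|s [sS sC hs]] := engel hbr hnil (M := fun=> True) _ nS.
  by move=> m x _ /(subvP SKer); apply: bS.
have sK := subvP SKer _ sS.
have := sK; rewrite (Ker_span_mixed hP) => /memv_addJline[_ [a [b [/memv_addJline[_ [al [be [/mem_Jline[c [d ->]] ->]]]] es]]]].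
have d0 : d = 0.
  apply/eqP/negPn/negP => dn; case/negP: JC_br_span.
  have -> : J C = d^-1 *: (s - c *: C - (al *: E + be *: J E) - (a *: h + b *: J h)).
    apply: (scalerI dn); rewrite scalerA mulfV // scale1r es.
    by apply: coord_ext => k; rewrite !(linearD,linearZ,linearN) /=; ring.
  by rewrite memvZ // !memvB // ?memvD // memvZ.
rewrite d0 scale0r addr0 in es.
have Fz z y : z \in <[C]>%VS -> F z y = 0.
  by move=> /vlineP[t ->]; rewrite !(kfE hT, kf_altE hT) mulr0.
have f1 : F (br W E) s = 0 by rewrite Frel1 // Fz // hs.
have f2 : F (J h) s = 0.
  have := Frel2 sK; rewrite JW_JE (Fz _ _ (hs _ Logic.I)) (kf3D hT) f1 (kf3Z hT) add0r.
  by move/eqP; rewrite mulf_eq0 pnatr_eq0 /= => /eqP.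
have f3 : F h s = 0.
  have := Frel3 sK; rewrite !(Fz _ _ (hs _ Logic.I)) addr0.
  by move/eqP; rewrite mulf_eq0 pnatr_eq0 /= => /eqP.
exists s, al, be, a, b, c; split=> [||m]; last exact: hs.
  by rewrite es -addrA addrC.
have [al0|] := eqVneq al 0; last by left.
have [be0|] := eqVneq be 0; last by right.
case/negP: sC; move: es; rewrite al0 be0 !scale0r !addr0 => es.
have n : F h (J h) != 0.
  by apply: (slice_neq0 hT C0); apply: contra hP; apply: mem_addvl.
have a0 : a = 0.
  apply/eqP; move/eqP: f2; rewrite es !(kfE hT, kf_altE hT) (slice_anti hT C (J h)).
  by rewrite !mulr0 add0r addr0 mulf_eq0 oppr_eq0 (negPf n) orbF.
have b0 : b = 0.
  apply/eqP; move/eqP: f3; rewrite es !(kfE hT, kf_altE hT).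
  by rewrite !mulr0 !add0r mulf_eq0 (negPf n) orbF.
by rewrite es a0 b0 !scale0r !addr0; apply/vlineP; exists c.
Qed.

End MixedNonzero.

End Slice.

Lemma adIm_line_of W W' : Im = (0 + Jline (D W))%VS -> D W' != 0 ->
  Im = (0 + Jline (D W'))%VS.
Proof.
move=> ImE E'0; have : D W' \in (0 + Jline (D W))%VS by rewrite -ImE.
case/memv_addJline=> i [a [b [i0 e]]]; rewrite ImE.
apply: (addJline_exchange JJ (a := a) (b := b)) => //; first by rewrite memv0.
by rewrite e addrK.
Qed.

Theorem no_central_line_false : False.
Proof.
have [W0 [_ [-> E00 DE0' ImE0]]] := adIm_line.
(* Moving W along <C, J C> does not change E = [J C, W]. *)
have CE : C \notin Jline (D W0).
  apply: contra C_Im; apply/subvP; rewrite ImE0 add0v; exact: subvv.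
have [p [q [o1 o2]]] := slice_project JJ hT E00 W0 CE.
set W := W0 + _ in o1 o2.
have DW : D W = D W0.
  by rewrite /W !(brE hbr) brC0 (brxx hbr) !scaler0 !addr0.
clearbody W.
have ImE := ImE0; rewrite -DW in o1 o2 E00 ImE.
have HW : T (D W) (J (D W)) (J C) W = 0 by rewrite (kf_J hT) o2 oppr0.
set h := br W (J (D W)).
have [hP|hP] := boolP (h \in (Jline C + Jline (D W))%VS).
  by apply: (mixed_eq0_false E00 ImE) HW; apply: (mixed_eq0 E00 ImE).
have [s [al [be [a [b [c [es nab hs]]]]]]] := second_center_normal_form E00 ImE hP.
(* The complex number al + i be is invertible, and it multiplies h by its square. *)
pose W' := al *: W + be *: J W.
have DW' : D W' = al *: D W + be *: J (D W) by rewrite /W' !(brE hbr) DJ.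
have n2 : al ^+ 2 + be ^+ 2 != 0.
  rewrite paddr_eq0 ?sqr_ge0 // !sqrf_eq0.
  by case: nab => /negPf ->; rewrite ?andbF.
have E'0 : D W' != 0.
  apply/eqP; rewrite DW' => /(Jline0 E00)[a0 b0].
  by move: n2; rewrite a0 b0 expr0n addr0 eqxx.
have ImE' := adIm_line_of ImE E'0.
have eh : br W' (J (D W')) = (al ^+ 2 - be ^+ 2) *: h + (2 * al * be) *: J h.
  rewrite DW' /W' linearD !linearZ /= JJ !(brE hbr) (JW_JE E00 ImE) (JW_E E00 ImE) -/h.
  by apply: coord_ext => k; rewrite !(linearD,linearZ,linearN) /=; ring.
set h' := br W' _ in eh.
have z0 : (al ^+ 2 - be ^+ 2) ^+ 2 + (2 * al * be) ^+ 2 != 0.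
  have -> : (al ^+ 2 - be ^+ 2) ^+ 2 + (2 * al * be) ^+ 2 = (al ^+ 2 + be ^+ 2) ^+ 2.
    by ring.
  by rewrite expf_neq0.
have hh' : h' \notin (Jline C + Jline (D W'))%VS.
  have -> : (Jline C + Jline (D W') = Jline C + Jline (D W))%VS.
    by move: ImE'; rewrite ImE !add0v => <-.
  rewrite eh; apply/negP => hh.
  have [u v] := Jstable_unit JJ (Jstable_add (@sl C) (@sl (D W))) hh hP.
  by move: z0; rewrite u v expr0n addr0 eqxx.
have [a' [b' e']] : exists a' b', a *: h + b *: J h = a' *: h' + b' *: J h'.
  have h0 : h' \notin 0%VS.
    by apply: contra hh'; rewrite memv0 => /eqP ->; apply: mem0v.
  have : h \in (0 + Jline h')%VS.
    have <- : (0 + Jline h = 0 + Jline h')%VS.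
      apply: (addJline_exchange JJ (a := al ^+ 2 - be ^+ 2) (b := 2 * al * be)) => //.
      by rewrite eh subrr mem0v.
    by rewrite mem_addvr // Jline_id.
  rewrite add0v => hl; have Jhl := sl hl.
  by apply/mem_Jline; rewrite memvD // memvZ.
apply: (second_center_normal_form_false E'0 ImE' hh' (s := s) (a := a') (b := b') (c := c)) hs.
by rewrite es e' -DW'.
Qed.

End NoCentralLine.

(** * The exterior product by recursion *)

Section Shuffle.
Variable n : nat.

(** Encodes a subset of the first n + 1 numbers by a bit for 0 and a subset B
    of the others. *)
Definition ext_set (b : bool) (B : {set 'I_n}) : {set 'I_n.+1} :=
  [set i | if unlift ord0 i is Some j then j \in B else b].

Lemma ext_set0 b B : (ord0 \in ext_set b B) = b.
Proof. by rewrite inE unlift_none. Qed.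

Lemma ext_set_lift b B i : (lift ord0 i \in ext_set b B) = (i \in B).
Proof. by rewrite inE liftK. Qed.

Lemma ext_setC b B : ~: ext_set b B = ext_set (~~ b) (~: B).
Proof. by apply/setP => i; rewrite !inE; case: unliftP => [j _|_]; rewrite ?inE. Qed.

Lemma big_ext_set (R : nmodType) (F : {set 'I_n.+1} -> R) :
  \sum_A F A = \sum_B F (ext_set true B) + \sum_B F (ext_set false B).
Proof.
rewrite (reindex (fun p : bool * {set 'I_n} => ext_set p.1 p.2)) /=.
  by rewrite -(pair_bigA _ (fun b B => F (ext_set b B))) big_bool.
exists (fun A : {set 'I_n.+1} => (@ord0 n \in A, [set i : 'I_n | lift (@ord0 n) i \in A])) => [[b B] _|A _] /=.
  by rewrite ext_set0; congr (_, _); apply/setP => i; rewrite inE ext_set_lift.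
apply/setP => i; rewrite inE; case: unliftP => [j ->|->] //.
by rewrite inE.
Qed.

Lemma card_inversions (A : {set 'I_n}) :
  #|[set ij : 'I_n * 'I_n | [&& (ij.1 < ij.2)%N, ij.1 \notin A & ij.2 \in A]]| =
  (\sum_(i < n) \sum_(j < n) [&& (i < j)%N, i \notin A & j \in A])%N.
Proof.
rewrite -sum1_card big_mkcond /= pair_bigA /=; apply: eq_bigr => -[i j] _ /=.
by rewrite inE /=; case: [&& _, _ & _].
Qed.

Lemma enum_ext_set b B :
  enum (ext_set b B) = (if b then [:: ord0] else [::]) ++ map (lift ord0) (enum B).
Proof.
have e m (C : {set 'I_m}) : enum C = [seq i <- enum 'I_m | i \in C].
  by rewrite {1}/enum_mem -enumT.
rewrite !e enum_ordSl /= ext_set0 filter_map.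
have -> : [seq i <- enum 'I_n | preim (lift ord0) (mem (ext_set b B)) i] =
          [seq i <- enum 'I_n | i \in B].
  by apply: eq_filter => i; rewrite /= ext_set_lift.
by case: b.
Qed.

End Shuffle.

(** When 0 is left out of the set, it forms an inversion with each of its
    elements. *)
Lemma inversions_ext_set n b (B : {set 'I_n}) :
  (\sum_(i < n.+1) \sum_(j < n.+1)
     [&& (i < j)%N, i \notin ext_set b B & j \in ext_set b B] =
   (~~ b) * #|B| + \sum_(i < n) \sum_(j < n) [&& (i < j)%N, i \notin B & j \in B])%N.
Proof.
rewrite big_ord_recl; congr (_ + _)%N.
  rewrite big_ord_recl /= ext_set0 add0n -sum1_card big_distrr /= [RHS]big_mkcond /=.
  apply: eq_bigr => j _; rewrite ext_set_lift.
  by case: b => /=; case: (j \in B).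
apply: eq_bigr => i _; rewrite big_ord_recl /= add0n.
by apply: eq_bigr => j _; rewrite !ext_set_lift.
Qed.

Section Forms.
Variables (R : realType) (V : vectType R).
Implicit Types (f h : extform V) (s : seq V).

(** The interior product of f with x. *)
Definition ctr (x : V) f : extform V := fun s => f (x :: s).
(** The sign that a form picks up when an interior product jumps over it. *)
Definition sgnf f : extform V := fun s => (-1) ^+ size s * f s.

Lemma size_subword (s : seq V) (A : {set 'I_(size s)}) : size (subword A) = #|A|.
Proof. by rewrite size_map -cardE. Qed.

Lemma subword_ext x s b (B : {set 'I_(size s)}) :
  @subword V (x :: s) (ext_set b B) = (if b then [:: x] else [::]) ++ subword B.
Proof.
rewrite /subword enum_ext_set map_cat -map_comp; congr (_ ++ _); last first.
  by apply: eq_map => i /=; rewrite !(tnth_nth x).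
by case: b => //=; rewrite (tnth_nth x).
Qed.

(** Interior products are antiderivations: the shuffles are split according to
    the factor that receives the first vector. *)
Lemma wedge_cons f h x s :
  wedge f h (x :: s) = wedge (ctr x f) h s + wedge (sgnf f) (ctr x h) s.
Proof.
rewrite {1}/wedge big_ext_set; congr (_ + _); apply: eq_bigr => B _.
  rewrite card_inversions inversions_ext_set mul0n add0n -card_inversions.
  by rewrite ext_setC !subword_ext.
rewrite card_inversions inversions_ext_set mul1n -card_inversions.
rewrite ext_setC !subword_ext /= /sgnf /ctr size_subword exprD.
by congr (_ * _); rewrite mulrA; congr (_ * _); apply: mulrC.
Qed.

Lemma wedge_nil f h : wedge f h [::] = f [::] * h [::].
Proof.
rewrite /wedge (big_pred1 set0) => [|A]; last first.
  by rewrite /=; apply/esym/eqP/setP => -[].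
rewrite (_ : [set _ | _] = set0); last by apply/setP => -[[]].
rewrite cards0 expr0 mul1r; congr (f _ * h _); apply/nilP; rewrite /nilp size_subword.
  by rewrite cards0.
by rewrite -leqn0 -[X in (_ <= X)%N](card_ord 0) max_card.
Qed.

End Forms.

(** * Alternating multilinear forms *)

Section FormAlgebra.
Local Open Scope complex_scope.
Variables (R : realType) (V : vectType R).
Implicit Types (f h : extform V) (s : seq V).
Local Notation unit_form := (@unit_form R V).

Lemma wedgeDl f f' h s :
  wedge (fun t => f t + f' t) h s = wedge f h s + wedge f' h s.
Proof.
by rewrite /wedge -big_split; apply: eq_bigr => A _; rewrite mulrDr mulrDl.
Qed.

Lemma wedgeDr f h h' s :
  wedge f (fun t => h t + h' t) s = wedge f h s + wedge f h' s.
Proof. by rewrite /wedge -big_split; apply: eq_bigr => A _; rewrite mulrDr. Qed.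

Lemma wedgeZl c f h s : wedge (fun t => c * f t) h s = c * wedge f h s.
Proof. by rewrite /wedge big_distrr; apply: eq_bigr => A _ /=; ring. Qed.

Lemma wedgeZr c f h s : wedge f (fun t => c * h t) s = c * wedge f h s.
Proof. by rewrite /wedge big_distrr; apply: eq_bigr => A _ /=; ring. Qed.

Lemma wedge0l f h s : (forall t, f t = 0) -> wedge f h s = 0.
Proof. by move=> f0; rewrite /wedge big1 // => A _; rewrite f0 mulr0 mul0r. Qed.

Lemma wedge0r f h s : (forall t, h t = 0) -> wedge f h s = 0.
Proof. by move=> h0; rewrite /wedge big1 // => A _; rewrite h0 mulr0. Qed.

Lemma conj_wedge f h : conj_form (wedge f h) = wedge (conj_form f) (conj_form h).
Proof.
apply/funext => s; rewrite /conj_form /wedge rmorph_sum; apply: eq_bigr => A _.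
by rewrite !rmorphM rmorphXn rmorphN rmorph1.
Qed.

Lemma wedge_unitl f : wedge unit_form f = f.
Proof.
apply/funext => s; elim: s f => [|x s IH] f.
  by rewrite wedge_nil /unit_form eqxx mul1r.
rewrite wedge_cons wedge0l // add0r.
rewrite (_ : sgnf unit_form = unit_form) ?IH //.
by apply/funext => -[|y t]; rewrite /sgnf /unit_form /= ?mul1r ?mulr0.
Qed.

Lemma wedge_unitr f : wedge f unit_form = f.
Proof.
apply/funext => s; elim: s f => [|x s IH] f.
  by rewrite wedge_nil /unit_form eqxx mulr1.
by rewrite wedge_cons IH addrC wedge0r // add0r.
Qed.

Definition homog (k : nat) f := forall s, size s != k -> f s = 0.

Lemma homog_wedge p q f h : homog p f -> homog q h -> homog (p + q) (wedge f h).
Proof.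
move=> hf hh s hs; rewrite /wedge big1 // => A _.
have [e|/hf ->] := eqVneq (size (subword A)) p; last by rewrite mulr0 mul0r.
rewrite hh ?mulr0 //; apply: contra hs => /eqP e'.
by rewrite -e -e' !size_subword cardsC card_ord.
Qed.

Lemma homog_cov a : homog 1 (cov a : extform V).
Proof. by case=> [|x [|y s]]. Qed.

Lemma homog_unit : homog 0 unit_form.
Proof. by case. Qed.

Lemma homog_conj k f : homog k f -> homog k (conj_form f).
Proof. by move=> hf s /hf e; rewrite /conj_form e rmorph0. Qed.

Lemma homog_scale k c f : homog k f -> homog k (scale_form c f).
Proof. by move=> hf s /hf e; rewrite /scale_form e mulr0. Qed.

Definition kills x f := forall t, f (x :: t) = 0.

Lemma kills_wedge x f h : kills x f -> kills x h -> kills x (wedge f h).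
Proof. by move=> kf kh t; rewrite wedge_cons wedge0l // wedge0r ?addr0. Qed.

Lemma kills_cov x a : a x = 0 -> kills x (cov a : extform V).
Proof. by move=> ax [|y t]. Qed.

Lemma kills_unit x : kills x unit_form. Proof. by []. Qed.

Lemma kills_conj x f : kills x f -> kills x (conj_form f).
Proof. by move=> k t; rewrite /conj_form k rmorph0. Qed.

Lemma kills_scale x c f : kills x f -> kills x (scale_form c f).
Proof. by move=> k t; rewrite /scale_form k mulr0. Qed.

Lemma wedge_peel f h (l s : seq V) : (forall x, x \in l -> kills x h) ->
  wedge f h (l ++ s) = wedge (fun t => f (l ++ t)) h s.
Proof.
elim: l f => [|x l IH] f kl //=.
rewrite wedge_cons [X in _ + X]wedge0r ?addr0; last by apply: kl; rewrite mem_head.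
by rewrite IH // => y yl; apply: kl; rewrite inE yl orbT.
Qed.

Lemma homog_cat f (l : seq V) : homog (size l) f ->
  (fun t => f (l ++ t)) = (fun t => f l * unit_form t).
Proof.
move=> hf; apply/funext => -[|x t]; rewrite /unit_form ?cats0 ?mulr1 //=.
by rewrite hf ?mulr0 // size_cat /= -[X in _ != X]addn0 eqn_add2l.
Qed.

(** As h vanishes on the vectors of l, only the shuffles that give all of l to
    f contribute. *)
Lemma wedge_split f h (l s : seq V) : homog (size l) f ->
  (forall x, x \in l -> kills x h) -> wedge f h (l ++ s) = f l * h s.
Proof.
by move=> hf kh; rewrite wedge_peel // homog_cat // wedgeZl wedge_unitl.
Qed.

Lemma wedge11 f h x y : homog 1 f -> homog 1 h ->
  wedge f h [:: x; y] = f [:: x] * h [:: y] - f [:: y] * h [:: x].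
Proof.
move=> hf hh; rewrite !(wedge_cons, wedge_nil) /ctr /sgnf /=.
rewrite !(hf [::]) // !(hf [:: _; _]) //; ring.
Qed.

Lemma wedge22 f h x y z t : homog 2 f -> homog 2 h ->
  wedge f h [:: x; y; z; t] =
    f [:: x; y] * h [:: z; t] - f [:: x; z] * h [:: y; t] +
    f [:: x; t] * h [:: y; z] + f [:: y; z] * h [:: x; t] -
    f [:: y; t] * h [:: x; z] + f [:: z; t] * h [:: x; y].
Proof.
move=> hf hh; rewrite !(wedge_cons, wedge_nil) /ctr /sgnf /=.
rewrite !(hf [::]) // !(hf [:: _]) // !(hf [:: _; _; _]) // !(hf [:: _; _; _; _]) //.
ring.
Qed.

Record multialt f : Prop := MultiAlt {
  ma_lin : forall s1 s2 (r : R) x y,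
    f (s1 ++ (r *: x + y) :: s2) = r%:C * f (s1 ++ x :: s2) + f (s1 ++ y :: s2);
  ma_alt : forall s1 x s2, f (s1 ++ x :: x :: s2) = 0 }.

Lemma multialt_ctr x f : multialt f -> multialt (ctr x f).
Proof.
move=> hf; split=> [s1 s2 r y z|s1 y s2]; rewrite /ctr -!cat_cons.
  exact: ma_lin.
exact: ma_alt.
Qed.

Lemma multialt_sgnf f : multialt f -> multialt (sgnf f).
Proof.
move=> hf; split=> [s1 s2 r y z|s1 y s2]; rewrite /sgnf.
  by rewrite (ma_lin hf) !size_cat /=; ring.
by rewrite (ma_alt hf) mulr0.
Qed.

Lemma multialt_wedge f h : multialt f -> multialt h -> multialt (wedge f h).
Proof.
move=> hf hh; split=> [s1 s2 r x y|s1 x s2].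
  elim: s1 f h hf hh => [|a s1 IH] f h hf hh /=.
    rewrite !wedge_cons.
    have -> : ctr (r *: x + y) f = fun t => r%:C * ctr x f t + ctr y f t.
      by apply/funext => t; apply: (ma_lin hf [::]).
    have -> : ctr (r *: x + y) h = fun t => r%:C * ctr x h t + ctr y h t.
      by apply/funext => t; apply: (ma_lin hh [::]).
    by rewrite wedgeDl wedgeDr wedgeZl wedgeZr; ring.
  rewrite !wedge_cons !IH; try ring; rewrite ?multialt_ctr ?multialt_sgnf //;
  by [apply: multialt_ctr | apply: multialt_sgnf].
elim: s1 f h hf hh => [|a s1 IH] f h hf hh /=.
  rewrite !wedge_cons.
  rewrite [X in X + _ + _]wedge0l; last by move=> t; apply: (ma_alt hf [::]).
  rewrite [X in _ + (_ + X)]wedge0r; last by move=> t; apply: (ma_alt hh [::]).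
  have -> : ctr x (sgnf f) = fun t => -1 * sgnf (ctr x f) t.
    by apply/funext => t; rewrite /ctr /sgnf /= exprS; ring.
  by rewrite wedgeZl; ring.
by rewrite wedge_cons !IH ?addr0 //; [apply: multialt_sgnf | apply: multialt_ctr | apply: multialt_ctr].
Qed.

Lemma multialt_unit : multialt unit_form.
Proof.
by split=> [[|b s1] s2 r x y|[|b s1] x s2]; rewrite /unit_form //= mulr0 addr0.
Qed.

Lemma multialt_conj f : multialt f -> multialt (conj_form f).
Proof.
move=> hf; split=> [s1 s2 r x y|s1 x s2]; rewrite /conj_form.
  by rewrite (ma_lin hf) rmorphD rmorphM [X in X * _]conjc_real.
by rewrite (ma_alt hf) rmorph0.
Qed.

Lemma multialt_scale c f : multialt f -> multialt (scale_form c f).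
Proof.
move=> hf; split=> [s1 s2 r x y|s1 x s2]; rewrite /scale_form.
  by rewrite (ma_lin hf); ring.
by rewrite (ma_alt hf) mulr0.
Qed.

Lemma multialt_cov a :
  (forall (r : R) x y, a (r *: x + y) = r%:C * a x + a y) ->
  multialt (cov a : extform V).
Proof.
move=> ha; split=> [[|b [|c s1]] [|d s2] r x y|[|b [|c s1]] x [|d s2]] //=;
  by rewrite ?ha ?mulr0 ?addr0.
Qed.

Lemma multialt_swap f s1 x y s2 : multialt f ->
  f (s1 ++ x :: y :: s2) = - f (s1 ++ y :: x :: s2).
Proof.
move=> hf; have := ma_alt hf s1 (1 *: x + y) s2.
rewrite (ma_lin hf) -!(cat_rcons _ s1) !(ma_lin hf) !cat_rcons !(ma_alt hf).
by rewrite !mul1r add0r addr0 => /eqP; rewrite addr_eq0 => /eqP.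
Qed.

Lemma multialt_perm f s t : multialt f -> perm_eq s t -> f s = 0 -> f t = 0.
Proof.
move=> hf; move: s t; apply: catCA_perm_ind => s1 s2 s3.
have key x u r v : f (r ++ x :: u ++ v) = 0 -> f (r ++ u ++ x :: v) = 0.
  elim: u r => [|y u IH] r //= h; rewrite -cat_rcons; apply: IH.
  by rewrite cat_rcons multialt_swap // h oppr0.
have key2 r u v w : f (r ++ u ++ v ++ w) = 0 -> f (r ++ v ++ u ++ w) = 0.
  elim: u r v => [|x u IH] r v h //=.
  have h' : f (r ++ x :: v ++ u ++ w) = 0.
    by rewrite -cat_rcons; apply: IH; rewrite cat_rcons.
  exact: key.
exact: (key2 [::]).
Qed.

Lemma multialt0 f s1 s2 : multialt f -> f (s1 ++ 0 :: s2) = 0.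
Proof.
move=> hf; have := ma_lin hf s1 s2 1 0 0.
by rewrite scaler0 addr0 mul1r => /eqP; rewrite -subr_eq0 opprD addrA subrr sub0r oppr_eq0 => /eqP.
Qed.

(** Expanding every argument in X leaves values on words in X; a word with a
    repetition gives 0 and the others are permutations of X. *)
Lemma multialt_basis_eq0 f (X : seq V) : multialt f -> homog (size X) f ->
  <<X>>%VS = {:V}%VS -> f X = 0 -> forall s, f s = 0.
Proof.
move=> hf hom fullX fX s.
suff h t1 t2 : all (mem X) t1 -> f (t1 ++ t2) = 0 by apply: (h [::] s).
elim: t2 t1 => [|x t2 IH] t1 t1X; last first.
  have xX : x \in <<in_tuple X>>%VS by rewrite /= fullX memvf.
  rewrite (coord_span xX).
  elim/big_rec: _ => [|i y _ IHy]; first exact: multialt0.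
  rewrite (ma_lin hf) IHy addr0 -cat_rcons IH ?mulr0 // all_rcons t1X andbT.
  by rewrite inE mem_nth.
rewrite cats0; have [sz|/hom //] := eqVneq (size t1) (size X).
have [ut|nu] := boolP (uniq t1).
  apply: (multialt_perm hf _ fX); rewrite perm_sym.
  have sub : {subset t1 <= X} by move=> x /(allP t1X).
  have szX : (size X <= size t1)%N by rewrite sz.
  have [_ eX] := uniq_min_size ut sub szX.
  by rewrite uniq_perm ?(leq_size_uniq ut sub szX).
have [x [u pu]] : exists x u, perm_eq t1 (x :: x :: u).
  elim: t1 nu {t1X sz} => //= x t IH; rewrite negb_and negbK => /orP[xt|/IH[y [u pu]]].
    by exists x, (rem x t); rewrite perm_cons perm_to_rem.
  exists y, (x :: u).
  rewrite (perm_trans (y := x :: y :: y :: u)) ?perm_cons //.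
  by rewrite -[x :: y :: y :: u]/([:: x] ++ [:: y; y] ++ u) perm_catCA.
apply: (multialt_perm hf (s := x :: x :: u)); first by rewrite perm_sym.
exact: (ma_alt hf [::]).
Qed.

End FormAlgebra.

(** * The differential of a 4-form *)

Section ExplicitForms.
Local Open Scope complex_scope.
Variables (R : realType) (V : vectType R).
Implicit Types (f h : extform V) (s : seq V).

Lemma subword_setC2 s (i j : 'I_(size s)) :
  subword (~: [set i; j]) =
  mask [seq ((k != i :> nat) && (k != j :> nat)) | k <- iota 0 (size s)] s.
Proof.
have e : enum (~: [set i; j]) = [seq k <- enum 'I_(size s) | k \in ~: [set i; j]].
  by rewrite {1}/enum_mem -enumT.
rewrite /subword e filter_mask map_mask (map_tnth_enum (in_tuple s)).
congr mask; rewrite -val_enum_ord -map_comp; apply: eq_map => k /=.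
by rewrite !inE negb_or.
Qed.

Lemma ce_diff5 (br : V -> V -> V) f a b c d e :
  ce_diff br f [:: a; b; c; d; e] =
    - f [:: br a b; c; d; e] + f [:: br a c; b; d; e] - f [:: br a d; b; c; e]
    + f [:: br a e; b; c; d] - f [:: br b c; a; d; e] + f [:: br b d; a; c; e]
    - f [:: br b e; a; c; d] - f [:: br c d; a; b; e] + f [:: br c e; a; b; d]
    - f [:: br d e; a; b; c].
Proof.
set s := [:: a; b; c; d; e].
pose G (i j : nat) : R[i] := (-1) ^+ (i + j) *
  f (br (nth 0 s i) (nth 0 s j) ::
     mask [seq ((k != i :> nat) && (k != j :> nat)) | k <- iota 0 5] s).
have -> : ce_diff br f s = \sum_(0 <= i < 5) \sum_(0 <= j < 5 | (i < j)%N) G i j.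
  rewrite /ce_diff big_mkord; apply: eq_bigr => i _.
  rewrite big_mkord; apply: eq_bigr => j _.
  by rewrite /G subword_setC2 !(tnth_nth 0).
rewrite unlock /= /G /= !exprS expr0; ring.
Qed.

End ExplicitForms.

(** * Forms of type (2,2) *)

Section TypedForms.
Local Open Scope complex_scope.
Variables (R : realType) (V : vectType R) (J : 'End(V)).
Hypothesis JJ : almost_complex J.
Implicit Types (f h : extform V) (s : seq V) (a b : V -> R[i]).
Local Notation unit_form := (@unit_form R V).

Definition cov2 a b : extform V := wedge (cov a) (cov b).

Lemma big_wedge2 (F : 'I_2 -> extform V) :
  \big[@wedge R V/unit_form]_(i < 2) F i = wedge (F 0) (F 1).
Proof.
rewrite !big_ord_recl big_ord0 wedge_unitr; congr (wedge (F _) (F _)); exact: val_inj.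
Qed.

Lemma homog_cov2 a b : homog 2 (cov2 a b).
Proof. by apply: (@homog_wedge _ _ 1 1); apply: homog_cov. Qed.

Lemma cov2E a b x y : cov2 a b [:: x; y] = a x * b y - a y * b x.
Proof. by rewrite /cov2 wedge11 //; apply: homog_cov. Qed.

Lemma multialt_cov2 a b : covector10 J a -> covector10 J b -> multialt (cov2 a b).
Proof. by move=> [ha _] [hb _]; apply: multialt_wedge; apply: multialt_cov. Qed.

Lemma multialt_sum m (c : 'I_m -> R[i]) (F : 'I_m -> extform V) :
  (forall k, multialt (F k)) -> multialt (fun s => \sum_(k < m) c k * F k s).
Proof.
move=> hF; split=> [s1 s2 r x y|s1 x s2].
  rewrite big_distrr -big_split; apply: eq_bigr => k _ /=.
  by rewrite (ma_lin (hF k)); ring.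
by rewrite big1 // => k _; rewrite (ma_alt (hF k)) mulr0.
Qed.

Lemma pq_form22P f : pq_form J 2 2 f <->
  exists m (c : 'I_m -> R[i]) (a a' b b' : 'I_m -> V -> R[i]),
   [/\ forall k, covector10 J (a k) /\ covector10 J (a' k),
       forall k, covector10 J (b k) /\ covector10 J (b' k) &
    f = fun s => \sum_(k < m) c k *
          wedge (cov2 (a k) (a' k)) (conj_form (cov2 (b k) (b' k))) s].
Proof.
split=> [[m [c [a [b [ha hb hf]]]]]|[m [c [a [a' [b [b' [ha hb hf]]]]]]]].
  exists m, c, (fun k => a k 0), (fun k => a k 1), (fun k => b k 0), (fun k => b k 1).
  split=> //; apply/funext => s; rewrite hf; apply: eq_bigr => k _.
  by rewrite !big_wedge2 conj_wedge.
exists m, c, (fun k i => if i == 0 then a k else a' k),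
  (fun k i => if i == 0 then b k else b' k); split.
- by move=> k i; case: ifP => _; case: (ha k).
- by move=> k i; case: ifP => _; case: (hb k).
move=> s; rewrite hf; apply: eq_bigr => k _.
by rewrite !big_wedge2 /= conj_wedge.
Qed.

Section Type22.
Variable f : extform V.
Hypothesis hf : pq_form J 2 2 f.

Lemma homog_conj_cov2 a b : homog 2 (conj_form (cov2 a b)).
Proof. by apply: homog_conj; apply: homog_cov2. Qed.

Lemma multialt_pq22 : multialt f.
Proof.
case/pq_form22P: hf => m [c [a [a' [b [b' [ha hb ->]]]]]].
apply: multialt_sum => k; have [h1 h2] := ha k; have [h3 h4] := hb k.
by apply: multialt_wedge; [|apply: multialt_conj]; apply: multialt_cov2.
Qed.

Lemma homog_pq22 : homog 4 f.
Proof.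
case/pq_form22P: hf => m [c [a [a' [b [b' [ha hb ->]]]]]] s hs.
rewrite big1 // => k _.
by rewrite (@homog_wedge _ _ 2 2) ?mulr0 //; [apply: homog_cov2|apply: homog_conj_cov2].
Qed.

Lemma conj_mulI (z : R[i]) : (('i%C * z)^*%C = - ('i%C * z^*%C))%R.
Proof. by case: z => x y; apply/eqP; rewrite eq_complex /=; apply/andP; split; apply/eqP; ring. Qed.

(** J acts on (p,q)-forms, as a derivation, by the scalar i (p - q). *)
Lemma type22_derivation x y z t :
  f [:: J x; y; z; t] + f [:: x; J y; z; t] + f [:: x; y; J z; t] +
  f [:: x; y; z; J t] = 0.
Proof.
case/pq_form22P: hf => m [c [a [a' [b [b' [ha hb ->]]]]]].
rewrite -!big_split big1 // => k _ /=.
have [[_ h1] [_ h2]] := ha k; have [[_ h3] [_ h4]] := hb k.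
rewrite !wedge22; try exact: homog_cov2; try exact: homog_conj_cov2.
rewrite /conj_form !cov2E !(rmorphB, rmorphM) /= !(h1, h2, h3, h4).
rewrite !conj_mulI.
ring.
Qed.

End Type22.

End TypedForms.

(** * Complex frames and their dual (1,0)-covectors *)

Section Frames.
Local Open Scope complex_scope.
Variables (R : realType) (V : vectType R) (J : 'End(V)).
Hypothesis JJ : almost_complex J.
Implicit Types (f h : extform V) (s l : seq V) (a b : V -> R[i]).
Local Notation unit_form := (@unit_form R V).
Local Notation Jline := (Jline J).

Lemma cov10_0 a : covector10 J a -> a 0 = 0.
Proof.
move=> [ha _]; have := ha 1 0 0; rewrite scaler0 addr0 mul1r => /eqP.
by rewrite -subr_eq0 opprD addrA subrr sub0r oppr_eq0 => /eqP.
Qed.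

Lemma cov10_lin a : covector10 J a ->
  forall (r : R) x y, a (r *: x + y) = r%:C * a x + a y.
Proof. by case. Qed.

Lemma cov10_Z a (r : R) x : covector10 J a -> a (r *: x) = r%:C * a x.
Proof.
by move=> ha; have := cov10_lin ha r x 0; rewrite addr0 cov10_0 // addr0.
Qed.

Lemma cov10_D a x y : covector10 J a -> a (x + y) = a x + a y.
Proof. by move=> ha; have := cov10_lin ha 1 x y; rewrite scale1r mul1r. Qed.

Lemma cov10_J a x : covector10 J a -> a (J x) = 'i%C * a x.
Proof. by case. Qed.

(** The complex linear functional with real part rho. *)
Lemma covector10_of_real (rho : V -> R) :
  (forall r x y, rho (r *: x + y) = r * rho x + rho y) ->
  covector10 J (fun x => (rho x)%:C - 'i%C * (rho (J x))%:C).
Proof.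
move=> rhoP; split=> [r x y|x].
  by rewrite linearP !rhoP !(rmorphD, rmorphM) /=; ring.
have -> : rho (J (J x)) = - rho x.
  have r0 : rho 0 = 0 by have := rhoP 1 0 0; rewrite scaler0 addr0; lra.
  by rewrite JJ -scaleN1r -[_ *: x]addr0 rhoP r0; ring.
by apply/eqP; rewrite eq_complex /=; apply/andP; split; apply/eqP; ring.
Qed.

Lemma covector10_separates x :
  (forall a, covector10 J a -> a x = 0) -> x = 0.
Proof.
move=> h; apply: coord_ext => i; rewrite linear0.
have rhoP r y z : coord (vbasis {:V}) i (r *: y + z) =
  r * coord (vbasis {:V}) i y + coord (vbasis {:V}) i z by rewrite linearP.
by have := h _ (covector10_of_real rhoP); move/(congr1 (fun z => complex.Re z)) => /=; lra.
Qed.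

Definition jlist l : seq V := flatten [seq [:: x; J x] | x <- l].

Lemma span_jlist x l : <<jlist (x :: l)>>%VS = (Jline x + <<jlist l>>)%VS.
Proof. by rewrite /= !span_cons addvA. Qed.

Lemma size_jlist l : size (jlist l) = (size l).*2.
Proof. by elim: l => //= x l ->. Qed.

Lemma nth_jlist l j : (j < size l)%N ->
  (jlist l)`_(j.*2) = l`_j /\ (jlist l)`_(j.*2.+1) = J l`_j.
Proof. by elim: l j => //= x l IH [|j] //= /IH. Qed.

Lemma jlist_mem l x : x \in jlist l -> exists2 y, y \in l & x = y \/ x = J y.
Proof.
case/flatten_mapP => y yl; rewrite !inE => /orP[/eqP ->|/eqP ->]; exists y; auto.
Qed.

Lemma covector10_eq a b l : covector10 J a -> covector10 J b ->
  <<jlist l>>%VS = {:V}%VS -> (forall x, x \in l -> a x = b x) -> a = b.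
Proof.
move=> ha hb full e; apply/funext => x.
have xX : x \in <<in_tuple (jlist l)>>%VS by rewrite /= full memvf.
rewrite (coord_span xX); elim/big_rec: _ => [|i z _ IH].
  by rewrite !cov10_0.
rewrite !cov10_lin // IH; congr (_ * _ + _).
have /jlist_mem[y yl [->|->]] : (jlist l)`_i \in jlist l by rewrite mem_nth.
  exact: e.
by rewrite !cov10_J // e.
Qed.

Lemma dual_frame n l : size l = n -> <<jlist l>>%VS = {:V}%VS ->
  \dim {:V} = n.*2 ->
  exists th : 'I_n -> V -> R[i], (forall k, covector10 J (th k)) /\
    forall k j : 'I_n, th k l`_j = (k == j)%:R.
Proof.
move=> sl full dV.
have sX : size (jlist l) = n.*2 by rewrite size_jlist sl.
have fX : free (jlist l) by rewrite /free full dV sX.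
pose X := in_tuple (jlist l).
have lt2 (k : 'I_n) : (k.*2 < size (jlist l))%N by rewrite sX ltn_double.
have lt3 (k : 'I_n) : (k.*2.+1 < size (jlist l))%N by rewrite sX ltn_Sdouble.
pose rho (k : 'I_n) x := coord X (Ordinal (lt2 k)) x.
exists (fun k x => (rho k x)%:C - 'i%C * (rho k (J x))%:C); split=> [k|k j].
  by apply: covector10_of_real => r x y; rewrite /rho linearP.
have jl : (j < size l)%N by rewrite sl.
have [<- <-] := nth_jlist jl.
have e1 := @coord_free _ _ _ X (Ordinal (lt2 j)) (Ordinal (lt2 k)) fX.
have e2 := @coord_free _ _ _ X (Ordinal (lt3 j)) (Ordinal (lt2 k)) fX.
have z : (Ordinal (lt3 j) == Ordinal (lt2 k)) = false.
  by apply/eqP => /(congr1 val) /= /(congr1 odd); rewrite /= !odd_double.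
have z' : (Ordinal (lt2 j) == Ordinal (lt2 k)) = (k == j).
  by rewrite -val_eqE /= -!muln2 eqn_pmul2r // eq_sym.
rewrite z' in e1; rewrite z in e2.
move: e1 e2; rewrite /rho /= => -> ->.
by rewrite mulr0n mulr0 subr0; case: (k == j).
Qed.

Lemma basis10_dual n l (th : 'I_n -> V -> R[i]) : size l = n ->
  <<jlist l>>%VS = {:V}%VS -> (forall k, covector10 J (th k)) ->
  (forall k j : 'I_n, th k l`_j = (k == j)%:R) -> basis10 J th.
Proof.
move=> sl full hth dual; split=> // b hb.
have val (c : 'rV[R[i]]_n) (j : 'I_n) : \sum_(k < n) c 0 k * th k l`_j = c 0 j.
  rewrite (bigD1 j) //= dual eqxx mulr1 big1 ?addr0 // => k kj.
  by rewrite dual (negPf kj) mulr0.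
have hsum (c : 'rV[R[i]]_n) : covector10 J (fun x => \sum_(k < n) c 0 k * th k x).
  split=> [r x y|x].
    rewrite big_distrr -big_split; apply: eq_bigr => k _ /=.
    by rewrite (cov10_lin (hth k)); ring.
  rewrite big_distrr; apply: eq_bigr => k _ /=.
  by rewrite cov10_J //; ring.
exists (\row_k b l`_k); split=> [x|c hc].
  apply: (congr1 (fun F : V -> R[i] => F x) (_ : b = fun x => _)).
  apply: (covector10_eq hb (hsum _) full) => y /(nthP 0)[j]; rewrite sl => jn <-.
  by rewrite (val _ (Ordinal jn)) mxE.
by apply/rowP => j; rewrite mxE hc val.
Qed.

End Frames.

(** * Volume forms *)

Section Volume.
Local Open Scope complex_scope.
Variables (R : realType) (V : vectType R) (J : 'End(V)).
Hypothesis JJ : almost_complex J.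
Implicit Types (f h : extform V) (s l : seq V) (a b : V -> R[i]).
Local Notation unit_form := (@unit_form R V).
Local Notation Jline := (Jline J).
Local Notation jlist := (jlist J).

Definition area a : extform V :=
  scale_form 'i%C (wedge (cov a) (conj_form (cov a))).
Definition vol n (a : 'I_n -> V -> R[i]) : extform V :=
  \big[@wedge R V/unit_form]_(j < n) area (a j).

Lemma homog_area a : homog 2 (area a).
Proof.
apply: homog_scale; apply: (@homog_wedge _ _ 1 1); first exact: homog_cov.
by apply: homog_conj; apply: homog_cov.
Qed.

Lemma multialt_area a : covector10 J a -> multialt (area a).
Proof.
move=> [ha _]; apply: multialt_scale; apply: multialt_wedge; first exact: multialt_cov.
by apply: multialt_conj; apply: multialt_cov.
Qed.

Lemma areaE a x : covector10 J a -> a x = 1 -> area a [:: x; J x] = 2.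
Proof.
move=> ha ax; rewrite /area /scale_form wedge11; last 2 first.
- exact: homog_cov.
- by apply: homog_conj; apply: homog_cov.
rewrite /conj_form /= (cov10_J _ ha) ax mulr1.
by apply/eqP; rewrite eq_complex /=; apply/andP; split; apply/eqP; ring.
Qed.

Lemma kills_area a x : a x = 0 -> kills x (area a).
Proof.
move=> ax; apply: kills_scale; apply: kills_wedge; first exact: kills_cov.
by apply: kills_conj; apply: kills_cov.
Qed.

Lemma homog_vol n (a : 'I_n -> V -> R[i]) : homog n.*2 (vol a).
Proof.
elim: n a => [|n IH] a; rewrite /vol ?big_ord0; first exact: homog_unit.
rewrite big_ord_recl; apply: (@homog_wedge _ _ 2 n.*2); first exact: homog_area.
exact: IH.
Qed.

Lemma multialt_vol n (a : 'I_n -> V -> R[i]) :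
  (forall j, covector10 J (a j)) -> multialt (vol a).
Proof.
elim: n a => [|n IH] a ha; rewrite /vol ?big_ord0; first exact: multialt_unit.
rewrite big_ord_recl; apply: multialt_wedge; first exact: multialt_area.
by apply: IH => j; apply: ha.
Qed.

Lemma kills_vol n (a : 'I_n -> V -> R[i]) x :
  (forall j, a j x = 0) -> kills x (vol a).
Proof.
elim: n a => [|n IH] a h; rewrite /vol ?big_ord0; first exact: kills_unit.
rewrite big_ord_recl; apply: kills_wedge; first exact: kills_area.
by apply: IH => j; apply: h.
Qed.

(** For l dual to a, the j-th factor is the only one that does not vanish on
    the j-th pair x, J x, and its value there is 2. *)
Lemma volE n (a : 'I_n -> V -> R[i]) l : size l = n ->
  (forall j, covector10 J (a j)) ->
  (forall k j : 'I_n, a k l`_j = (k == j)%:R) -> vol a (jlist l) = 2 ^+ n.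
Proof.
elim: n a l => [|n IH] a [|x l] //= sl ha dual.
  by rewrite /vol big_ord0 /unit_form.
case: sl => sl; rewrite /vol big_ord_recl.
have d0 : a ord0 x = 1 by have := dual ord0 ord0; rewrite /= => ->.
have dS k : a (lift ord0 k) x = 0 by have := dual (lift ord0 k) ord0.
rewrite (@wedge_split _ _ _ _ [:: x; J x]); last 2 first.
- exact: homog_area.
- move=> y; rewrite !inE => yx; apply: kills_vol => j.
  by case/orP: yx => /eqP ->; rewrite ?(cov10_J _ (ha _)) dS ?mulr0.
rewrite areaE // exprS; congr (_ * _); apply: IH => // k j.
by have := dual (lift ord0 k) (lift ord0 j); rewrite (inj_eq lift_inj).
Qed.

(** The real and imaginary parts of the a j embed V in a space of the same
    dimension, because (1,0)-covectors separate points. *)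
Lemma basis10_dual_vectors n (a : 'I_n -> V -> R[i]) : \dim {:V} = n.*2 ->
  basis10 J a -> exists2 l, size l = n & forall k j : 'I_n, a k l`_j = (k == j)%:R.
Proof.
move=> dV [ha hspan].
pose phi (x : V) : 'rV[R]_(n + n) :=
  row_mx (\row_j complex.Re (a j x)) (\row_j complex.Im (a j x)).
have phi_lin : linear phi.
  move=> r x y; rewrite /phi scale_row_mx add_row_mx; congr row_mx; apply/rowP => j;
    rewrite !mxE (cov10_lin (ha j)); case: (a j x) => ? ?; case: (a j y) => ? ? /=; ring.
pose Lphi : {linear V -> 'rV[R]_(n + n)} :=
  HB.pack phi (GRing.isLinear.Build _ _ _ _ phi phi_lin).
pose Phi : 'Hom(V, 'rV[R]_(n + n)) := linfun Lphi.
have PhiE x : Phi x = phi x by rewrite lfunE.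
have phi0 x : phi x = 0 -> forall j, a j x = 0.
  move=> e j; have eR := congr1 (fun M : 'rV[R]_(n + n) => M 0 (lshift n j)) e.
  have eI := congr1 (fun M : 'rV[R]_(n + n) => M 0 (rshift n j)) e.
  move: eR eI; rewrite /phi row_mxEl row_mxEr !mxE.
  by case: (a j x) => u v /= -> ->.
have ker0 : lker Phi = 0%VS.
  apply/eqP; rewrite -subv0; apply/subvP => x; rewrite memv_ker PhiE => /eqP /phi0 ax.
  rewrite memv0; apply/eqP; apply: (covector10_separates JJ) => b /hspan[c [-> _]].
  by rewrite big1 // => j _; rewrite ax mulr0.
have full : limg Phi = fullv.
  apply/eqP; rewrite eqEdim subvf /= limg_dim_eq ?ker0 ?capv0 //.
  by rewrite dV dimvf dim_matrix mul1r addnn.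
have ex (j : 'I_n) : exists y, forall k, a k y = (k == j)%:R.
  have : row_mx (\row_k (k == j)%:R) 0 \in limg Phi by rewrite full memvf.
  case/memv_imgP => y _; rewrite PhiE => e; exists y => k.
  have eR := congr1 (fun M : 'rV[R]_(n + n) => M 0 (lshift n k)) e.
  have eI := congr1 (fun M : 'rV[R]_(n + n) => M 0 (rshift n k)) e.
  move: eR eI; rewrite /phi !row_mxEl !row_mxEr !mxE.
  by case: (a k y) => u v /= <- <-; case: (k == j).
have [y hy] := choice ex.
exists [seq y j | j <- enum 'I_n]; first by rewrite size_map size_enum_ord.
move=> k j; rewrite (nth_map j) ?size_enum_ord //.
by rewrite nth_ord_enum hy.
Qed.

Lemma volume_form_neq0 n f : cdim V = n -> \dim {:V} = n.*2 ->
  volume_form J f -> exists s, f s != 0.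
Proof.
rewrite /volume_form => -> dV [c [a [c0 ha ef]]].
have [l sl dual] := basis10_dual_vectors dV ha.
exists (jlist l); rewrite ef /scale_form -/(vol a) volE //; last by case: ha.
by rewrite mulf_neq0 ?expf_neq0 ?pnatr_eq0 // ?fmorph_eq0 ?gt_eqF.
Qed.

End Volume.

(** * From transverse (2,2)-forms to the real 4-form *)

Section Dim8.
Local Open Scope complex_scope.
Variables (R : realType) (V : vectType R) (J : 'End(V)).
Hypothesis JJ : almost_complex J.
Hypothesis dV : \dim {:V} = 8%N.
Implicit Types (f h : extform V) (s l : seq V) (a b : V -> R[i]).
Local Notation Jline := (Jline J).
Local Notation jlist := (jlist J).

Lemma cdim8 : cdim V = 4%N. Proof. by rewrite /cdim dV. Qed.

Let sl x : Jstable J (Jline x). Proof. exact: Jstable_line. Qed.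
Lemma span_jlist4 (x y u v : V) : x != 0 -> y \notin Jline x ->
  u \notin (Jline x + Jline y)%VS -> v \notin (Jline x + Jline y + Jline u)%VS ->
  <<jlist [:: x; y; u; v]>>%VS = {:V}%VS.
Proof.
move=> x0 hy hu hv; rewrite !span_jlist /= span_nil addv0.
rewrite (addvA (Jline x) (Jline y)) (addvA _ (Jline u) (Jline v)).
apply/eqP; rewrite eqEdim subvf dV.
have s2 := Jstable_add (@sl x) (@sl y); have s3 := Jstable_add s2 (@sl u).
by rewrite (dim_addJline JJ s3 hv) (dim_addJline JJ s2 hu) (dim_addJline JJ _ hy) // (dim_Jline JJ x0).
Qed.

Lemma exists_notin (U : {vspace V}) : (\dim U < 8)%N -> exists z, z \notin U.
Proof.
move=> h; have /subvPn[z _ hz] : ~~ ({:V} <= U)%VS.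
  by apply/negP => /dimvS; rewrite dV leqNgt h.
by exists z.
Qed.

Lemma frame_completion (x y : V) : x != 0 -> y \notin Jline x ->
  exists u v, [/\ u \notin (Jline x + Jline y)%VS,
    v \notin (Jline x + Jline y + Jline u)%VS &
    <<jlist [:: x; y; u; v]>>%VS = {:V}%VS].
Proof.
move=> x0 hy.
have d2 := dim_addJline JJ (@sl x) hy; rewrite (dim_Jline JJ x0) in d2.
have s2 := Jstable_add (@sl x) (@sl y).
have [|u hu] := @exists_notin (Jline x + Jline y)%VS; first by rewrite d2.
have d3 := dim_addJline JJ s2 hu; rewrite d2 in d3.
have [|v hv] := @exists_notin (Jline x + Jline y + Jline u)%VS; first by rewrite d3.
by exists u, v; split=> //; apply: span_jlist4.
Qed.

Lemma top_form_split f h l s : homog (size l) f ->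
  (forall x, x \in l -> kills x h) ->
  wedge (wedge f h) (conj_form h) (l ++ s) = f l * wedge h (conj_form h) s.
Proof.
move=> hf kh; rewrite wedge_peel; last by move=> x /kh; apply: kills_conj.
have -> : (fun t => wedge f h (l ++ t)) = fun t => f l * h t.
  by apply/funext => t; rewrite wedge_split.
by rewrite wedgeZl.
Qed.

(** Take for the simple form the product h of the two covectors dual to u and
    v, so that its kernel is spanned by x and y. On the frame x, y, u, v the
    volume form of the definition is a multiple of f x (J x) y (J y), and a
    nonzero form of top degree cannot vanish on a frame. *)
Lemma transverse_neq0 f (x y : V) : transverse J 2 f -> x != 0 -> y \notin Jline x ->
  f [:: x; J x; y; J y] != 0.
Proof.
move=> [pq tr] x0 hy; apply/eqP => f0.
have [u [v [_ _ full]]] := frame_completion x0 hy.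
have [th [hth dual]] := dual_frame (n := 4) (l := [:: x; y; u; v]) JJ erefl full dV.
pose a := th (@Ordinal 4 2 isT); pose b := th (@Ordinal 4 3 isT).
pose h := cov2 a b.
have dl4 (k j : 'I_4) : th k (nth 0 [:: x; y; u; v] j) = (k == j)%:R by apply: dual.
have ax : a x = 0 by have := dl4 (@Ordinal 4 2 isT) (@Ordinal 4 0 isT).
have ay : a y = 0 by have := dl4 (@Ordinal 4 2 isT) (@Ordinal 4 1 isT).
have au : a u = 1 by have := dl4 (@Ordinal 4 2 isT) (@Ordinal 4 2 isT).
have av : a v = 0 by have := dl4 (@Ordinal 4 2 isT) (@Ordinal 4 3 isT).
have bx : b x = 0 by have := dl4 (@Ordinal 4 3 isT) (@Ordinal 4 0 isT).
have by_ : b y = 0 by have := dl4 (@Ordinal 4 3 isT) (@Ordinal 4 1 isT).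
have bu : b u = 0 by have := dl4 (@Ordinal 4 3 isT) (@Ordinal 4 2 isT).
have bv : b v = 1 by have := dl4 (@Ordinal 4 3 isT) (@Ordinal 4 3 isT).
have ha : covector10 J a by apply: hth.
have hb : covector10 J b by apply: hth.
have hs : simple_form J (cdim V - 2) h.
  rewrite cdim8; exists (fun j => if j == 0 then a else b); split.
    by move=> j; case: ifP.
  by move=> s; rewrite big_wedge2.
have hn : exists s, h s != 0.
  by exists [:: u; v]; rewrite /h cov2E au av bu bv mulr1 mul0r subr0 oner_neq0.
have [s /negP[]] := volume_form_neq0 JJ (n := 4) cdim8 dV (tr h hs hn).
apply/eqP; rewrite /scale_form; apply/eqP; rewrite mulf_eq0; apply/orP; right; apply/eqP.
have mf := multialt_pq22 pq; have hf := homog_pq22 pq.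
have mh : multialt h by apply: (multialt_cov2 ha hb).
have hh : homog 2 h by apply: homog_cov2.
apply: (@multialt_basis_eq0 _ _ _ (jlist [:: x; y; u; v]) _ _ full).
- apply: multialt_wedge; first exact: multialt_wedge.
  exact: multialt_conj.
- apply: (@homog_wedge _ _ 6 2); last exact: homog_conj.
  exact: (@homog_wedge _ _ 4 2).
have kill z : a z = 0 -> b z = 0 -> kills z h.
  by move=> az bz; apply: kills_wedge; apply: kills_cov.
have := @top_form_split f h [:: x; J x; y; J y] [:: u; J u; v; J v] hf.
rewrite f0 mul0r; apply => z; rewrite !inE.
by case/or4P => /eqP ->; apply: kill; rewrite ?(cov10_J _ ha) ?(cov10_J _ hb) ?ax ?ay ?bx ?by_ ?mulr0.
Qed.

Lemma kahler_form_of_p_kahler br (Omega : extform V) :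
  p_kahler br J 2 Omega ->
  kahler_form br J (fun p q r t : V => complex.Re (Omega [:: p; q; r; t])).
Proof.
move=> [_ re tr cl]; have pq := tr.1.
have mf := multialt_pq22 pq; have hf := homog_pq22 pq.
have ReN (z : R[i]) : complex.Re (- z) = - complex.Re z by case: z.
have ReB (z w : R[i]) : complex.Re (z + w) = complex.Re z + complex.Re w.
  by case: z; case: w.
split.
- move=> r a a' b c d; have := ma_lin mf [::] [:: b; c; d] r a a'; rewrite /= => ->.
  rewrite ReB; congr (_ + _); case: (Omega _) => p q /=; ring.
- by move=> a b c d; rewrite (multialt_swap [::]) //.
- by move=> a b c d; rewrite (multialt_swap [:: a]) //.
- by move=> a b c d; rewrite (multialt_swap [:: a; b]) //.
- move=> x y v; have := type22_derivation pq x (J x) y v.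
  rewrite (ma_alt mf [::]) JJ -scaleN1r.
  have := ma_lin mf [:: x] [:: y; v] (-1) x 0; rewrite /= addr0 => ->.
  rewrite (multialt0 [:: x]) // (ma_alt mf [::]) mulr0 !add0r => /eqP.
  by rewrite addr_eq0 => /eqP ->; rewrite ReN.
- move=> x y x0 hy; have := transverse_neq0 tr x0 hy.
  apply: contra => /eqP e; rewrite eq_complex /= e eqxx /=.
  have := re [:: x; J x; y; J y]; rewrite /conj_form.
  by case: (Omega _) => p q /= [] /eqP; rewrite eq_sym -addr_eq0 -mulr2n mulrn_eq0 /=.
move=> a b c d e; have := cl [:: a; b; c; d; e]; rewrite ce_diff5.
move/(congr1 (@complex.Re R)); rewrite !(ReB, ReN) /=; lra.
Qed.

End Dim8.

(** * The flat 2-Kahler form *)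

Section FlatModel.
Local Open Scope complex_scope.
Variables (R : realType) (V : vectType R) (J : 'End(V)).
Hypothesis JJ : almost_complex J.
Hypothesis dV : \dim {:V} = 8%N.
Implicit Types (f h : extform V) (s l : seq V).
Local Notation Jline := (Jline J).
Local Notation jlist := (jlist J).

Definition normsq (z : R[i]) : R := complex.Re z ^+ 2 + complex.Im z ^+ 2.

Lemma normsq_ge0 z : 0 <= normsq z.
Proof. by rewrite addr_ge0 // sqr_ge0. Qed.

Lemma normsq_eq0 z : normsq z = 0 -> z = 0.
Proof.
case: z => p q /eqP; rewrite paddr_eq0 ?sqr_ge0 // !sqrf_eq0 /= => /andP[/eqP -> /eqP ->] //.
Qed.

Lemma cov2_conj_wedgeE (a b : V -> R[i]) x y : covector10 J a -> covector10 J b ->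
  wedge (cov2 a b) (conj_form (cov2 a b)) [:: x; J x; y; J y] =
  (4 * normsq (cov2 a b [:: x; y]))%:C.
Proof.
move=> ha hb; rewrite wedge22; [|exact: homog_cov2|exact: homog_conj_cov2].
rewrite /conj_form !cov2E !(cov10_J _ ha) !(cov10_J _ hb) /normsq.
case: (a x) (a y) (b x) (b y) => [a1 a2] [a3 a4] [b1 b2] [b3 b4].
by apply/eqP; rewrite eq_complex /=; apply/andP; split; apply/eqP; ring.
Qed.

Section Model.
Variables (e : seq V) (a : 'I_4 -> V -> R[i]).
Hypothesis se : size e = 4%N.
Hypothesis full : <<jlist e>>%VS = {:V}%VS.
Hypothesis ha : forall j, covector10 J (a j).
Hypothesis dual : forall k j : 'I_4, a k e`_j = (k == j)%:R.

Let m := #|{: 'I_4 * 'I_4}|.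
Let A (k : 'I_m) : extform V := cov2 (a (enum_val k).1) (a (enum_val k).2).
(** The square of the flat Kahler form, the sum over j of i a_j /\ conj a_j,
    with the two holomorphic factors moved to the front. *)
Definition flat_form : extform V :=
  fun s => \sum_(k < m) 1 * wedge (A k) (conj_form (A k)) s.

Lemma flat_pq : pq_form J 2 2 flat_form.
Proof.
apply/pq_form22P; exists m, (fun=> 1), (fun k => a (enum_val k).1),
  (fun k => a (enum_val k).2), (fun k => a (enum_val k).1), (fun k => a (enum_val k).2).
by split.
Qed.

Lemma flat_real : real_form flat_form.
Proof.
move=> s; rewrite /conj_form /flat_form rmorph_sum; apply: eq_bigr => k _.
rewrite !mul1r.
rewrite [LHS](_ : _ = wedge (conj_form (A k)) (A k) s); last first.
  rewrite -[LHS]/(conj_form (wedge (A k) (conj_form (A k))) s) conj_wedge.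
  congr (wedge _ _ s); apply/funext => t; exact: conjcK.
have hA : homog 2 (A k) by apply: homog_cov2.
have hB : homog 2 (conj_form (A k)) by apply: homog_conj.
have [|ns] := eqVneq (size s) 4%N; last first.
  by rewrite !(@homog_wedge _ _ 2 2).
case: s => [|x [|y [|z [|t []]]]] // _.
by rewrite !wedge22 //; ring.
Qed.

Lemma a_separates (x : V) : (forall j, a j x = 0) -> x = 0.
Proof.
move=> h; apply: (covector10_separates JJ) => b hb.
have [_ /(_ b hb)[c [-> _]]] := basis10_dual se full ha dual.
by rewrite big1 // => j _; rewrite h mulr0.
Qed.

(** The value is 4 times the sum of the squared moduli of the 2 x 2 minors of
    (a_i x, a_i y); if all of them vanish, y is a complex multiple of x. *)
Lemma flat_pos (x y : V) : x != 0 -> y \notin Jline x ->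
  exists2 t : R, 0 < t & flat_form [:: x; J x; y; J y] = t%:C.
Proof.
move=> x0 hy.
exists (\sum_(k < m) 4 * normsq (A k [:: x; y])); last first.
  rewrite /flat_form rmorph_sum; apply: eq_bigr => k _.
  by rewrite mul1r cov2_conj_wedgeE.
have ge k : 0 <= 4 * normsq (A k [:: x; y]) by rewrite mulr_ge0 ?normsq_ge0 // ler0n.
rewrite lt_neqAle sumr_ge0 // andbT; apply/eqP => /esym /psumr_eq0P h.
have {}h k : A k [:: x; y] = 0.
  by apply: normsq_eq0; have := h (fun k _ => ge k) k isT => /eqP;
     rewrite mulf_eq0 pnatr_eq0 /= => /eqP.
have [i ai] : exists i, a i x != 0.
  apply/existsP; apply: contraNT x0; rewrite negb_exists => /forallP h'.
  by apply/eqP/a_separates => j; apply/eqP; move: (h' j); rewrite negbK.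
case/negP: hy; apply/mem_Jline.
pose z := a i y / a i x.
exists (complex.Re z), (complex.Im z); apply/eqP; rewrite -subr_eq0; apply/eqP/a_separates => j.
have hj := h (enum_rank (i, j)); rewrite /A enum_rankK cov2E in hj.
have aj := ha j.
have -> : a j (y - (complex.Re z *: x + complex.Im z *: J x)) = a j y - z * a j x.
  rewrite -scaleN1r (cov10_D _ _ aj) (cov10_Z _ _ aj) (cov10_D _ _ aj) !(cov10_Z _ _ aj).
  rewrite (cov10_J _ aj); case: z => p q; case: (a j x) (a j y) => [? ?] [? ?].
  by apply/eqP; rewrite eq_complex /=; apply/andP; split; apply/eqP; ring.
apply: (mulfI ai); rewrite mulr0 -[RHS]hj /z.
by field.
Qed.

(** Complete vectors p, q on which the simple form h does not vanish by a
    basis x, y of the kernel of h. Both sides of the required identity are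
    forms of top degree, so they are compared on this frame, where the left
    side is the product of two positive numbers. *)
Lemma flat_transverse : transverse J 2 flat_form.
Proof.
split; first exact: flat_pq.
rewrite (cdim8 dV) => h [mu [hmu /funext eh]] [s hs].
rewrite big_wedge2 -/(cov2 _ _) in eh.
have h0 := hmu 0; have h1 := hmu 1.
set m0 := mu 0 in eh h0; set m1 := mu 1 in eh h1.
have hh : homog 2 h by rewrite eh; apply: homog_cov2.
have [p [q hpq]] : exists p q, h [:: p; q] != 0.
  have [|/hh e0] := eqVneq (size s) 2%N; last by rewrite e0 eqxx in hs.
  by case: s hs => [|p [|q []]] // hs _; exists p, q.
have det : m0 p * m1 q - m0 q * m1 p != 0 by move: hpq; rewrite eh cov2E.
have p0 : p != 0.
  apply: contra det => /eqP ->.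
  by rewrite (cov10_0 h0) (cov10_0 h1) mul0r mulr0 subr0.
have cs (b : V -> R[i]) : covector10 J b -> forall z w,
    b (complex.Re z *: w + complex.Im z *: J w) = z * b w.
  move=> hb z w; rewrite (cov10_D _ _ hb) !(cov10_Z _ _ hb) (cov10_J _ hb).
  case: z => u v; case: (b w) => ? ?.
  by apply/eqP; rewrite eq_complex /=; apply/andP; split; apply/eqP; ring.
have qp : q \notin Jline p.
  apply: contra det => /mem_Jline[u [v ->]].
  by rewrite (cs _ h0 (u +i* v)) (cs _ h1 (u +i* v)); apply/eqP; ring.
have sl x : Jstable J (Jline x) by apply: Jstable_line.
have s2 := Jstable_add (sl p) (sl q).
(* Cramer's rule removes the components of w on p and q. *)
have proj w : exists w', [/\ w' - w \in (Jline p + Jline q)%VS, m0 w' = 0 & m1 w' = 0].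
  pose d := m0 p * m1 q - m0 q * m1 p.
  pose z1 := - (m0 w * m1 q - m0 q * m1 w) / d.
  pose z2 := - (m0 p * m1 w - m0 w * m1 p) / d.
  exists (w + ((complex.Re z1 *: p + complex.Im z1 *: J p) +
               (complex.Re z2 *: q + complex.Im z2 *: J q))); split.
  - rewrite addrAC subrr add0r memv_add //; apply/mem_Jline; by do 2 eexists.
  - rewrite (cov10_D _ _ h0) (cov10_D _ _ h0) !(cs _ h0) /z1 /z2 /d; by field.
  - rewrite (cov10_D _ _ h1) (cov10_D _ _ h1) !(cs _ h1) /z1 /z2 /d; by field.
have [x0 [y0 [hx0 hy0 _]]] := frame_completion JJ dV p0 qp.
have [x [mx x1 x2]] := proj x0; have [y [my y1 y2]] := proj y0.
have hx : x \notin (Jline p + Jline q)%VS.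
  by apply: contra hx0 => hx; rewrite -(subKr x x0) memvB.
have s2x : (Jline p + Jline q + Jline x0 = Jline p + Jline q + Jline x)%VS.
  apply: (addJline_exchange JJ (a := 1) (b := 0)) => //.
  by rewrite scale1r scale0r addr0.
have hy : y \notin (Jline p + Jline q + Jline x)%VS.
  apply: contra hy0 => hy; rewrite s2x -(subKr y y0) memvB //.
  exact: mem_addvl.
have fullpq := span_jlist4 JJ dV p0 qp hx hy.
have fullx : <<jlist [:: x; y; p; q]>>%VS = {:V}%VS.
  rewrite -fullpq !span_jlist /= span_nil !addv0.
  rewrite (addvA (Jline x) (Jline y)) (addvC (_ + _)%VS).
  by rewrite -(addvA (Jline p) (Jline q) (Jline x + Jline y)%VS).
have xn0 : x != 0 by apply: contra hx => /eqP ->; apply: mem0v.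
have hyx : y \notin Jline x by apply: contra hy; apply: mem_addvr.
have [t t0 ht] := flat_pos xn0 hyx.
pose l := [:: x; y; p; q].
have [th [hth dth]] := dual_frame (n := 4) (l := l) JJ erefl fullx dV.
have bth : basis10 J th by apply: (basis10_dual (l := l)).
pose r := t * (4 * normsq (h [:: p; q])).
have r0 : 0 < r.
  rewrite !mulr_gt0 // ?ltr0n // lt_neqAle normsq_ge0 andbT eq_sym.
  by apply: contra hpq => /eqP /normsq_eq0 ->.
rewrite /volume_form (cdim8 dV); exists (r / 2 ^+ 4), th; split=> //.
  by rewrite divr_gt0 ?exprn_gt0 ?ltr0n.
pose nu := wedge (wedge flat_form h) (conj_form h).
have mh : multialt h by rewrite eh; apply: (multialt_cov2 h0 h1).
have mO := multialt_pq22 flat_pq; have hO := homog_pq22 flat_pq.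
have mnu : multialt nu.
  apply: multialt_wedge; first exact: multialt_wedge.
  exact: multialt_conj.
have hnu : homog 8 nu.
  apply: (@homog_wedge _ _ 6 2); last exact: homog_conj.
  exact: (@homog_wedge _ _ 4 2).
have mv := multialt_vol hth; have hv := homog_vol th.
have nuE : nu (jlist l) = r%:C.
  rewrite /nu [LHS](@top_form_split _ _ _ _ [:: x; J x; y; J y] [:: p; J p; q; J q]) //; last first.
    move=> z; rewrite !inE eh => hz; apply: kills_wedge; apply: kills_cov;
    by case/or4P: hz => /eqP ->; rewrite ?(cov10_J _ h0) ?(cov10_J _ h1) ?x1 ?x2 ?y1 ?y2 ?mulr0.
  by rewrite ht {1}eh {1}eh cov2_conj_wedgeE // -/m0 -/m1 -eh -rmorphM.
have i4 : 'i%C ^+ (2 ^ 2) = 1 :> R[i] by rewrite (exprM _ 2 2) sqr_i sqrrN expr1n.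
pose phi : extform V := fun s => nu s + (- (r / 2 ^+ 4)%:C) * vol th s.
have mphi : multialt phi.
  split=> [s1 s3 c u v|s1 u s3]; rewrite /phi.
    by rewrite (ma_lin mnu) (ma_lin mv); ring.
  by rewrite (ma_alt mnu) (ma_alt mv) mulr0 addr0.
have hphi : homog 8 phi by move=> u hu; rewrite /phi hnu // hv // mulr0 addr0.
have phi0 : phi (jlist l) = 0.
  rewrite /phi nuE volE // mulNr.
  have -> : (2 : R[i]) ^+ 4 = (2 ^+ 4)%:C by rewrite rmorphXn rmorph_nat.
  by rewrite -rmorphM /= divfK ?subrr // expf_neq0 // pnatr_eq0.
move=> u; have := multialt_basis_eq0 mphi (X := jlist l) hphi fullx phi0 u.
rewrite /phi /scale_form i4 mul1r mulNr => /eqP.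
by rewrite subr_eq0 => /eqP e0; exact: e0.
Qed.

End Model.
End FlatModel.

(** * The theorem *)

Lemma kahler_form_abelian (R : realType) (g : vectType R) (br : g -> g -> g)
    (J : 'End(g)) (T : g -> g -> g -> g -> R) :
  lie_bracket br -> lie_nilpotent br -> complex_structure br J ->
  \dim {:g} = 8%N -> kahler_form br J T -> lie_abelian br.
Proof.
move=> hbr hnil hJ hdim hT.
have [[C [C0 h1 h2]]|noline] := pselect (exists C : g,
    [/\ C != 0, forall x, br x C = 0 & forall x, br x (J C) = 0]).
  exact: (central_line_abelian hbr hnil hJ hdim hT C0 h1 h2).
have n0 : ~~ ({:g} <= 0)%VS by rewrite subv0 -dimv_eq0 hdim.
have [|C [_ C0 hC]] := engel hbr hnil (M := fun=> True) _ n0.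
  by move=> m x _ _; apply: memvf.
case: (no_central_line_false hbr hnil hJ hdim hT _ (C := C)).
- by move=> x x0 hx hJx; case: noline; exists x.
- by rewrite -memv0.
- by move=> x; apply/eqP; rewrite -memv0; apply: hC.
Qed.

Lemma abelian_p_kahler (R : realType) (g : vectType R) (br : g -> g -> g)
    (J : 'End(g)) : almost_complex J -> \dim {:g} = 8%N -> lie_abelian br ->
  exists Omega : extform g, p_kahler br J 2 Omega.
Proof.
move=> JJ hdim ab.
have [x x0] : exists x : g, x \notin 0%VS by apply: exists_notin; rewrite ?dimv0.
rewrite memv0 in x0.
have [y hy] : exists y : g, y \notin Jline J x.
  by apply: (exists_notin hdim); rewrite (dim_Jline JJ x0).
have [u [v [_ _ full]]] := frame_completion JJ hdim x0 hy.
have [a [ha dual]] := dual_frame (n := 4) (l := [:: x; y; u; v]) JJ erefl full hdim.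
exists (flat_form a); split.
- by rewrite (cdim8 hdim).
- exact: flat_real.
- exact: (flat_transverse JJ hdim (e := [:: x; y; u; v])).
move=> s; rewrite /ce_diff big1 // => i _; rewrite big1 // => j _.
by rewrite ab (multialt0 [::]) ?mulr0 //; apply: multialt_pq22 (flat_pq ha).
Qed.

Theorem theorem3p7 (R : realType) (g : vectType R) (br : g -> g -> g)
    (hbr : lie_bracket br) (hdim : \dim {:g} = 8%N) (hnil : lie_nilpotent br)
    (J : 'End(g)) (hJ : complex_structure br J) :
  (exists Omega : extform g, p_kahler br J 2 Omega) <-> lie_abelian br.
Proof.
split=> [[Omega /(kahler_form_of_p_kahler hJ.1 hdim) hT]|].
  exact: (kahler_form_abelian hbr hnil hJ hdim hT).
exact: abelian_p_kahler hJ.1 hdim.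
Qed.
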